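(* Let $y$ be the solution of the delay differential problem $$\dot y(t)=f(y(t),y(t-\tau)),\quad t\in[t_0,T],\qquad y(t_0)=y_0,\qquad y(t)=\phi(t),\quad t\in[t_0-\tau,t_0),$$ with $\tau=\nu h$, $T-t_0=K\tau$, $K,\nu\in\mathbb N$, $t_n=t_0+nh$ for $n=-\nu,\dots,N\equiv K\nu$. Let $s\ge1$ and let $u_n$, $y_n=u_n(h)$ be the quadrature-based piecewise approximation and grid values defined in the context, and $\hat\sigma_n(ch):=y(t_{n-1}+ch)$. Assuming that the quadrature formula has order $q\ge2s$, for $n=1,\dots,N\equiv K\nu$ one has $$y(t_n)-y_n=y(t_{n-1})-y_{n-1}+O(h^{2s+1}),\qquad \max_{c\in[0,1]}|\hat\sigma_n(ch)-u_n(ch)|=O(h^{s+1}).$$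
   Context: $f:\mathbb R^m\times\mathbb R^m\to\mathbb R^m$ and $\phi:[t_0-\tau,t_0]\to\mathbb R^m$ are assumed suitably regular (as smooth as needed); $\tau>0$ is a constant delay; usually $y_0=\phi(t_0)$; $y$ is the solution on $[t_0,T]$. $|\cdot|$ is any vector norm. $\{P_j\}_{j\ge0}$ is the orthonormal Legendre basis on $[0,1]$: $P_j$ is a polynomial of degree $j$, $\int_0^1P_i(x)P_j(x)\,dx=\delta_{ij}$, $P_0\equiv1$. $(c_i,b_i)_{i=1}^k$ are the (distinct) abscissae and weights of an interpolatory quadrature on $[0,1]$; it has order $q$ if $\sum_{i=1}^kb_ip(c_i)=\int_0^1p(x)\,dx$ for all polynomials $p$ of degree at most $q-1$. For functions $z,w$ on $[0,h]$ set $\hat\gamma_j(z,w):=\sum_{i=1}^kb_iP_j(c_i)f(z(c_ih),w(c_ih))$. For $n=1-\nu,\dots,0$: $u_n(ch)=\phi(t_{n-1}+ch)$, $c\in[0,1]$. For $n=1,\dots,N$, $u_n$ is the $\mathbb R^m$-valued polynomial of degree at most $s$ defined successively, starting from $y_0$, by $$u_n(ch)=y_{n-1}+h\sum_{j=0}^{s-1}\int_0^cP_j(x)\,dx\,\hat\gamma_j(u_n,u_{n-\nu}),\quad c\in[0,1],\qquad y_n:=u_n(h)=y_{n-1}+h\hat\gamma_0(u_n,u_{n-\nu})$$ ($h$ being small enough for $u_n$ to be well defined). The $O(\cdot)$ symbols refer to $h=\tau/\nu\to0$ (i.e. $\nu\to\infty$ with $\tau$ and $K$ fixed), with constants uniform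 in $n$. *)

(* Defs.v *)
From mathcomp Require Export all_boot all_order all_algebra.
From mathcomp Require Export all_classical all_reals all_analysis.
Export Order.TTheory GRing.Theory Num.Theory.
Export numFieldNormedType.Exports.

Set Implicit Arguments.
Unset Strict Implicit.
Unset Printing Implicit Defensive.

Global Open Scope classical_set_scope.
Global Open Scope ring_scope.

Record vector_norm (R : realType) (V : lmodType R) (N : V -> R) : Prop := {
  vector_norm_ge0 : forall v, 0 <= N v;
  vector_norm_eq0 : forall v, N v = 0 -> v = 0;
  vector_normZ : forall (a : R) v, N (a *: v) = `|a| * N v;
  vector_normD : forall v w, N (v + w) <= N v + N w }.

(* In finite dimension, f is of class C^(r+1) iff it is Frechet differentiable
   everywhere and all the maps x |-> f'(x) v are of class C^r. *)
Fixpoint class_C (R : realType) (V W : normedModType R) (r : nat)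
    (f : V -> W) : Prop :=
  match r with
  | 0%N => continuous f
  | r'.+1 => (forall x, differentiable f x) /\
             (forall v, class_C r' (fun x => 'd f x v))
  end.

(* Class C^r on the closed interval [a, b]: only the values of g on [a, b]
   matter, and the derivatives D i (i <= r) on ]a, b[ extend continuously to
   [a, b]. *)
Definition class_C_itv (R : realType) (W : normedModType R) (r : nat)
    (a b : R) (g : R -> W) : Prop :=
  exists D : nat -> R -> W,
    [/\ forall x, a <= x <= b -> D 0%N x = g x,
        forall i, (i <= r)%N -> {within `[a, b], continuous (D i)} &
        forall i x, (i < r)%N -> a < x < b -> is_derive x 1 (D i) (D i.+1 x)].

(* y' at t0 and T is one-sided, and is then determined by the other equations
   and the continuity of y on [t0, T].  If y0 <> phi t0, the delayed argument
   y (t - tau) jumps at t = t0 + tau, so that y only has one-sided derivatives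
   there, again determined by the rest; hence t0 + tau is exempted. *)
Record dde_solution (R : realType) (m : nat)
    (f : 'rV[R]_m * 'rV[R]_m -> 'rV[R]_m) (phi : R -> 'rV[R]_m)
    (y0 : 'rV[R]_m) (t0 T tau : R) (y : R -> 'rV[R]_m) : Prop := {
  dde_cont : {within `[t0, T], continuous y};
  dde_eq : forall t, t0 < t < T -> t != t0 + tau ->
    is_derive t 1 y (f (y t, y (t - tau)));
  dde_init : y t0 = y0;
  dde_history : forall t, t0 - tau <= t < t0 -> y t = phi t }.

Record legendre_basis (R : realType) (P : nat -> {poly R}) : Prop := {
  legendre_size : forall j, size (P j) = j.+1;
  legendre_orthonormal : forall i j,
    \int[lebesgue_measure]_(x in `[0, 1]) ((P i).[x] * (P j).[x]) =
      (i == j)%:R;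
  legendre0 : P 0%N = 1 }.

Record interpolatory_quadrature (R : realType) (k : nat)
    (b c : 'I_k -> R) : Prop := {
  quad_abscissae : forall i, 0 <= c i <= 1;
  quad_distinct : injective c;
  quad_weights : forall i, b i =
    \int[lebesgue_measure]_(x in `[0, 1])
      \prod_(j < k | j != i) ((x - c j) / (c i - c j)) }.

Definition quadrature_order (R : realType) (k : nat) (b c : 'I_k -> R)
    (q : nat) : Prop :=
  forall p : {poly R}, (size p <= q)%N ->
    \sum_(i < k) b i * p.[c i] = \int[lebesgue_measure]_(x in `[0, 1]) p.[x].

Definition gamma_hat (R : realType) (m k : nat)
    (f : 'rV[R]_m * 'rV[R]_m -> 'rV[R]_m) (P : nat -> {poly R})
    (b c : 'I_k -> R) (h : R) (j : nat) (z w : R -> 'rV[R]_m) : 'rV[R]_m :=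
  \sum_(i < k) (b i * (P j).[c i]) *: f (z (c i * h), w (c i * h)).

(* u n is a function on [0, h], n = 1 - nu, ..., N (u and yn are not constrained
   elsewhere).  The equation of step n is nonlinear and may have, however small
   h is, spurious solutions escaping to infinity as h -> 0 (e.g. for
   f (y, w) = y ^ 2); apx_near, with rho independent of h, selects the intended
   one, which is the only one within distance rho of yn (n - 1) for h small. *)
Record pw_approximation (R : realType) (m k s : nat)
    (f : 'rV[R]_m * 'rV[R]_m -> 'rV[R]_m) (P : nat -> {poly R})
    (b c : 'I_k -> R) (phi : R -> 'rV[R]_m) (y0 : 'rV[R]_m) (t0 h rho : R)
    (nu N : nat) (u : int -> R -> 'rV[R]_m) (yn : int -> 'rV[R]_m) : Prop := {
  apx_history : forall (n : int) (a : R), 1 - nu%:Z <= n <= 0 ->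
    0 <= a <= 1 -> u n (a * h) = phi (t0 + (n - 1)%:~R * h + a * h);
  apx_init : yn 0 = y0;
  apx_poly : forall n : int, 1 <= n <= N%:Z -> forall i : 'I_m,
    exists2 p : {poly R}, (size p <= s.+1)%N &
      forall x, 0 <= x <= h -> u n x 0 i = p.[x];
  apx_step : forall (n : int) (a : R), 1 <= n <= N%:Z -> 0 <= a <= 1 ->
    u n (a * h) = yn (n - 1) +
      h *: \sum_(j < s) (\int[lebesgue_measure]_(x in `[0, a]) (P j).[x]) *:
             gamma_hat f P b c h j (u n) (u (n - nu%:Z));
  apx_grid : forall n : int, 1 <= n <= N%:Z -> yn n = u n h;
  apx_near : forall (n : int) (a : R), 1 <= n <= N%:Z -> 0 <= a <= 1 ->
    `|u n (a * h) - yn (n - 1)| <= rho }.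

(* Main.v *)
From HB Require Import structures.
Require Import Defs.
From mathcomp Require Import ring lra zify.

Set Implicit Arguments.
Unset Strict Implicit.
Unset Printing Implicit Defensive.

(** Fix a step and let [e x] be the error at time [t_(n-1) + x h], with value
    [e0] at [x = 0].  Let [proj] be the projection onto polynomials of degree
    less than [s] that the quadrature turns into a finite sum.  Then
      [e x = e0 + D x + h * primitive (proj g) x],
    where [D] is the defect of the exact solution and [g] is the difference of
    the two values of [f].  A contraction argument gives [e = O(|e0| + h^(s+1))]
    ([error_node], [error_point]), which explains the uniform estimate but is
    only half of what is needed at the grid points.

    The missing half is carried by an invariant that is weaker than size: the
    moments of the error.  For all [n], [h^n * quad ((1 - x)^n e)] is
    [O(|e0| + h^(2s))] ([moment_small]).  Up to quadratic terms, which are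
    negligible since [2 (s + 1) > 2 s], [g] is a linear combination of [e] and of
    the delayed error, whose coefficients are smooth functions of the time: their
    Taylor coefficient at [(1 - x)^l] is [O(h^l)], exactly what is lost when a
    moment of order [n] becomes one of order [n + l].  So [g] inherits the
    estimate ([g_moment]).  Since [(1 - x)^(n+1)] vanishes at 1 and a primitive
    vanishes at 0, an integration by parts without boundary term expresses the
    moment of order [n] of [e] by the one of order [n + 1] of [g], with a factor
    [h] ([quad_primitive_proj]); moments of order at least [s - 1] are small
    because [e] is, and a downward induction on [n] covers the others.  The
    moment of order 0 of [g] then bounds the increment of the error over the step
    by [O(h (|e0| + h^(2s)))] ([error_end]).  All the integrals involved are
    integrals of polynomials of degree less than [2 s], which the quadrature
    computes exactly; the defect is treated in the same way, monomial by monomial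
    ([defect_point], [defect_moment], [defect_end]).

    The delayed error enters through its size and its moments only, that is,
    through what has just been proved for the preceding delay interval.  This
    allows an induction on the delay intervals ([piece_bounds]), on each of which
    the solution is smooth up to the end points ([delayed_smooth]), while a
    discrete Gronwall lemma ([gronwall]) bounds [e0] along the interval.

    Constants must not depend on [rho].  The bound of [f] on a ball of radius
    depending on [rho] is used once, to show that for [h] small the numerical
    solution moves by at most 1 during a step ([piece_step]).  All the other
    constants come from a fixed ball around the solution, so that [rho] only
    affects how small [h] has to be. *)

(** * Antiderivatives of polynomials *)

Section Primitive.
Context {R : realType}.
Implicit Types p q : {poly R}.

Definition primitive p : {poly R} :=
  \poly_(i < (size p).+1) (p`_i.-1 / i%:R).

Lemma coef_primitive p i : (primitive p)`_i = p`_i.-1 / i%:R.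
Proof.
rewrite coef_poly; case: ltnP => // lti; case: i lti => [|i] // lti.
by rewrite nth_default ?mul0r.
Qed.

Lemma size_primitive p : (size (primitive p) <= (size p).+1)%N.
Proof. exact: size_poly. Qed.

Lemma primitive_at0 p : (primitive p).[0] = 0.
Proof. by rewrite horner_coef0 coef_primitive invr0 mulr0. Qed.

Lemma deriv_primitive p : (primitive p)^`() = p.
Proof.
apply/polyP => i; rewrite coef_deriv coef_primitive -[LHS]mulr_natr /=.
by rewrite -mulrA mulVf ?mulr1 //.
Qed.

Lemma primitive_is_linear : linear primitive.
Proof.
move=> a p q; apply/polyP => i.
by rewrite !(coefD, coefZ, coef_primitive) mulrDl mulrA.
Qed.

HB.instance Definition _ :=
  GRing.isLinear.Build R {poly R} {poly R} *:%R primitive primitive_is_linear.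

Lemma primitive_deriv p : primitive p^`() = p - (p.[0])%:P.
Proof.
apply/polyP => i; rewrite coef_primitive coefB coefC coef_deriv.
case: i => [|i]; first by rewrite invr0 mulr0 horner_coef0 subrr.
by rewrite /= subr0 -[X in X / _]mulr_natr mulfK // pnatr_eq0.
Qed.

Lemma Rintegral_poly p (a : R) : 0 <= a ->
  \int[lebesgue_measure]_(x in `[0, a]) p.[x] = (primitive p).[a].
Proof.
rewrite le_eqVlt => /predU1P[<-|a0].
  by rewrite set_itv1 Rintegral_set1 primitive_at0.
have cont q : {within `[0, a], continuous (horner q)}.
  by apply: continuous_subspaceT; exact: continuous_horner.
rewrite /Rintegral (@continuous_FTC2 _ (horner p) (horner (primitive p)) 0 a) //.
- by rewrite /= primitive_at0 subr0.
- split=> [x _||]; first exact: derivable_horner.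
  + by apply: cvg_at_right_filter; exact: continuous_horner.
  + by apply: cvg_at_left_filter; exact: continuous_horner.
- by move=> x _; rewrite -derivE deriv_primitive.
Qed.

(** Integration by parts; there is no boundary term, because [(1 - x) ^ k.+1]
    vanishes at 1 and [primitive p] vanishes at 0. *)
Lemma primitive_by_parts p k :
  (primitive ((1 - 'X) ^+ k * primitive p)).[1] =
  (primitive ((1 - 'X) ^+ k.+1 * p)).[1] / k.+1%:R.
Proof.
have k0 : k.+1%:R != 0 :> R by rewrite pnatr_eq0.
have d1 : ((1 - 'X : {poly R}) ^+ k.+1)^`() = - (k.+1%:R *: (1 - 'X) ^+ k).
  rewrite deriv_exp derivB derivX derivC sub0r mulN1r scaler_nat.
  by rewrite mulNrn.
have := primitive_deriv ((1 - 'X) ^+ k.+1 * primitive p).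
rewrite derivM deriv_primitive d1 mulNr -scalerAl linearD linearN linearZ /=.
move=> /(congr1 (horner^~ 1)).
rewrite !hornerE !primitive_at0 subrr expr0n /= !(mulr0, mul0r, subr0).
set A := (primitive _).[1]; set B := (primitive _).[1] => e.
by apply: (mulfI k0); rewrite [RHS]mulrC divfK //; lra.
Qed.

Lemma poly_sum_coef p n : (size p <= n)%N ->
  p = \sum_(l < n) p`_l *: 'X^l.
Proof.
move=> sp; rewrite -poly_def; apply/polyP => i; rewrite coef_poly.
by case: ltnP => // ni; rewrite nth_default // (leq_trans sp).
Qed.

End Primitive.

(** * Quadrature and the discrete Legendre projection *)

Section Quadrature.
Context {R : realType} {k : nat}.
Variables (b c : 'I_k -> R) (s : nat) (P : nat -> {poly R}).
Hypothesis exact_quad : quadrature_order b c (2 * s).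
Hypothesis basisP : legendre_basis P.

Definition quad (g : R -> R) : R := \sum_(l < k) b l * g (c l).

Lemma quadD g1 g2 : quad (fun x => g1 x + g2 x) = quad g1 + quad g2.
Proof. by rewrite -big_split; apply: eq_bigr => l _; rewrite mulrDr. Qed.

Lemma quadZ a g : quad (fun x => a * g x) = a * quad g.
Proof. by rewrite mulr_sumr; apply: eq_bigr => l _; rewrite mulrCA. Qed.

Lemma quadB g1 g2 : quad (fun x => g1 x - g2 x) = quad g1 - quad g2.
Proof.
rewrite /quad -sumrB; apply: eq_bigr => l _; by rewrite mulrBr.
Qed.

Lemma quad_sum (J : Type) (r : seq J) (p : pred J) (G : J -> R -> R) :
  quad (fun x => \sum_(j <- r | p j) G j x) = \sum_(j <- r | p j) quad (G j).
Proof.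
rewrite /quad exchange_big /=; apply: eq_bigr => l _; exact: mulr_sumr.
Qed.

Lemma eq_quad g1 g2 : (forall x, g1 x = g2 x) -> quad g1 = quad g2.
Proof. by move=> eg; apply: eq_bigr => l _; rewrite eg. Qed.

Lemma quad_poly (p : {poly R}) : (size p <= 2 * s)%N ->
  quad (horner p) = (primitive p).[1].
Proof. by move=> sp; rewrite -Rintegral_poly // -exact_quad. Qed.

(** The discrete counterpart of the orthogonal projection onto polynomials of
    degree less than [s]: the numerical solution is affine in [primitive (proj g)]
    with [g] the values of the right-hand side. *)
Definition proj (g : R -> R) : {poly R} :=
  \sum_(j < s) quad (fun x => (P j).[x] * g x) *: P j.

Lemma size_P_le (j : 'I_s) : (size (P j) <= s)%N.
Proof. by rewrite legendre_size. Qed.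

Lemma size_proj g : (size (proj g) <= s)%N.
Proof.
apply: (leq_trans (size_sum _ _ _)); apply/bigmax_leqP => j _.
exact: leq_trans (size_scale_leq _ _) (size_P_le j).
Qed.

Lemma size_mul_le (p q : {poly R}) n1 n2 : (size p <= n1)%N ->
  (size q <= n2.+1)%N -> (size (p * q)%R <= n1 + n2)%N.
Proof.
move=> sp sq; apply: leq_trans (size_polyMleq _ _) _; lia.
Qed.

(** Products of two basis elements have degree at most [2 * s - 2], so that the
    discrete inner product coincides with the one of L^2 on them. *)
Lemma quad_orthonormal (i j : 'I_s) :
  quad (fun x => (P i).[x] * (P j).[x]) = (i == j)%:R.
Proof.
rewrite -[RHS](legendre_orthonormal basisP) -/(eq_op _ _).
under [RHS]eq_Rintegral do rewrite -hornerM.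
rewrite -exact_quad; last first.
  apply: leq_trans (size_polyMleq _ _) _; rewrite !legendre_size //.
  by case: i j => i lti [j ltj] /=; lia.
by apply: eq_bigr => l _; rewrite hornerM.
Qed.

Lemma legendre_span n (p : {poly R}) : (size p <= n)%N ->
  exists al : 'I_n -> R, p = \sum_(j < n) al j *: P j.
Proof.
elim: n p => [|n IHn] p.
  rewrite leqn0 size_poly_eq0 => /eqP ->.
  by exists (fun=> 0); rewrite big_ord0.
move=> sp; pose a := p`_n / lead_coef (P n).
have [|al def_p] := IHn (p - a *: P n).
  apply/leq_sizeP => i ni; rewrite coefB coefZ.
  have sPn := legendre_size basisP n.
  have [->|] := eqVneq i n; last first.
    move=> ne_in; have lt_ni : (n < i)%N by rewrite ltn_neqAle eq_sym ne_in.
    by rewrite !nth_default ?mulr0 ?subr0 ?sPn // (leq_trans sp).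
  have lcn : (P n)`_n = lead_coef (P n) by rewrite lead_coefE sPn.
  rewrite lcn divfK ?subrr // lead_coef_eq0 -size_poly_eq0 sPn //.
exists (fun j => if unlift ord_max j is Some j' then al j' else a).
rewrite big_ord_recr /= unlift_none -[LHS](subrK (a *: P n)) def_p.
congr (_ + _); apply: eq_bigr => j _.
have -> : widen_ord (leqnSn n) j = lift ord_max j.
  by apply/val_inj; rewrite /= /bump leqNgt ltn_ord.
by rewrite liftK.
Qed.

Lemma proj_id (p : {poly R}) : (size p <= s)%N -> proj (horner p) = p.
Proof.
move=> /legendre_span[al ->]; apply: eq_bigr => j _; congr (_ *: _).
under eq_quad do rewrite horner_sum mulr_sumr.
rewrite quad_sum (bigD1 j) //= big1 ?addr0 => [|i ne_ij].
  under eq_quad do rewrite hornerZ mulrCA.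
  by rewrite quadZ quad_orthonormal eqxx mulr1.
under eq_quad do rewrite hornerZ mulrCA.
by rewrite quadZ quad_orthonormal eq_sym (negPf ne_ij) mulr0.
Qed.

Lemma quad_mul_proj (p : {poly R}) g : (size p <= s)%N ->
  quad (fun x => p.[x] * (proj g).[x]) = quad (fun x => p.[x] * g x).
Proof.
move=> sp; rewrite -[in RHS](proj_id sp) /proj.
under eq_quad do rewrite horner_sum mulr_sumr.
rewrite quad_sum; under [RHS]eq_quad do rewrite horner_sum mulr_suml.
rewrite quad_sum; apply: eq_bigr => j _.
under eq_quad do rewrite hornerZ mulrCA.
under [RHS]eq_quad do rewrite hornerZ -mulrA.
rewrite !quadZ mulrC; congr (_ * _).
by apply: eq_quad => l; rewrite mulrC.
Qed.

Lemma projD g1 g2 : proj (fun x => g1 x + g2 x) = proj g1 + proj g2.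
Proof.
rewrite /proj -big_split; apply: eq_bigr => j _.
by rewrite /= -scalerDl -quadD; congr (_ *: _); apply: eq_quad => l; rewrite mulrDr.
Qed.

Lemma projZ a g : proj (fun x => a * g x) = a *: proj g.
Proof.
rewrite /proj scaler_sumr; apply: eq_bigr => j _.
by rewrite scalerA -quadZ; congr (_ *: _); apply: eq_quad => l; rewrite mulrCA.
Qed.

Lemma projB g1 g2 : proj (fun x => g1 x - g2 x) = proj g1 - proj g2.
Proof.
rewrite -[- proj g2]scaleN1r -projZ -projD; congr proj.
by apply/funext => x; rewrite mulN1r.
Qed.

Lemma size_onem_exp n : (size ((1 - 'X : {poly R}) ^+ n)%R <= n.+1)%N.
Proof.
elim: n => [|n IHn]; first by rewrite expr0 size_poly1.
rewrite exprS mulrC; apply: leq_trans (size_mul_le (n2 := 1) IHn _) _; last lia.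
apply: leq_trans (size_polyD _ _) _.
by rewrite size_polyN size_polyX size_poly1.
Qed.

(** The source of superconvergence.  Both sides of the integration by parts have
    degree less than [2 * s], and [(1 - x) ^ n.+1] has degree less than [s], so
    that the projection may be dropped once it is tested against it. *)
Lemma quad_primitive_proj n g : (n + 2 <= s)%N ->
  quad (fun x => (1 - x) ^+ n * (primitive (proj g)).[x]) =
  quad (fun x => (1 - x) ^+ n.+1 * g x) / n.+1%:R.
Proof.
move=> ns.
have sz1 : (size ((1 - 'X : {poly R}) ^+ n.+1)%R <= s)%N.
  by apply: leq_trans (size_onem_exp _) _; lia.
transitivity ((primitive ((1 - 'X) ^+ n * primitive (proj g))).[1]).
  rewrite -quad_poly; last first.
    apply: leq_trans (size_mul_le (n2 := s) (size_onem_exp n) _) _; last lia.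
    by apply: leq_trans (size_primitive _) _; rewrite ltnS size_proj.
  by apply: eq_quad => l; rewrite !hornerE.
rewrite primitive_by_parts -quad_poly; last first.
  apply: leq_trans (size_mul_le (n2 := s) sz1 _) _; last lia.
  by apply: leq_trans (size_proj g) _.
congr (_ / _).
under eq_quad do rewrite hornerM.
rewrite quad_mul_proj //; apply: eq_quad => l.
by rewrite !hornerE.
Qed.

Hypothesis s_gt0 : (0 < s)%N.

Lemma primitive_proj_at1 g : (primitive (proj g)).[1] = quad g.
Proof.
rewrite -quad_poly; last by apply: leq_trans (size_proj g) _; lia.
transitivity (quad (fun x => (1 : {poly R}).[x] * (proj g).[x])).
  by apply: eq_quad => l; rewrite hornerE mul1r.
rewrite quad_mul_proj ?size_poly1 //; apply: eq_quad => l.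
by rewrite hornerE mul1r.
Qed.

(** The part of the integral of [p] that is lost when [p] is replaced by its
    projection; the defect of the method is the sum of these contributions over
    the Taylor expansion of the derivative of the solution. *)
Definition proj_defect (p : {poly R}) : {poly R} :=
  primitive p - primitive (proj (horner p)).

Lemma proj_defect_is_linear : linear proj_defect.
Proof.
move=> a p q; rewrite /proj_defect linearP.
have -> : proj (horner (a *: p + q)) = a *: proj (horner p) + proj (horner q).
  rewrite -projZ -projD; congr proj; apply/funext => x.
  by rewrite hornerD hornerZ.
by rewrite linearP scalerBr opprD addrACA.
Qed.

HB.instance Definition _ :=
  GRing.isLinear.Build R {poly R} {poly R} *:%R proj_defect
    proj_defect_is_linear.

Lemma proj_defect_low (p : {poly R}) : (size p <= s)%N -> proj_defect p = 0.
Proof. by move=> sp; rewrite /proj_defect proj_id // subrr. Qed.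

(** Against [(1 - x) ^ n] the loss is not seen by the quadrature, although it is
    not zero: the integration by parts reduces it to the orthogonality of
    [p - proj p] to polynomials of degree less than [s]. *)
Lemma proj_defect_moment (p : {poly R}) n : (n + 2 <= s)%N -> (size p + n < 2 * s)%N ->
  quad (fun x => (1 - x) ^+ n * (proj_defect p).[x]) = 0.
Proof.
move=> ns pn; have sz1 : (size ((1 - 'X : {poly R}) ^+ n.+1 * p)%R <= 2 * s)%N.
  rewrite mulrC; apply: leq_trans (size_mul_le (leqnn _) (size_onem_exp _)) _.
  by lia.
under eq_quad do rewrite hornerD hornerN mulrBr.
rewrite quadB quad_primitive_proj //; apply/eqP; rewrite subr_eq0; apply/eqP.
transitivity ((primitive ((1 - 'X) ^+ n * primitive p)).[1]).
  rewrite -quad_poly; last first.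
    rewrite mulrC; apply: leq_trans (size_mul_le _ (size_onem_exp n)) _.
    - exact: size_primitive.
    - by lia.
  by apply: eq_quad => l; rewrite !hornerE.
rewrite primitive_by_parts -quad_poly //; congr (_ / _).
by apply: eq_quad => l; rewrite !hornerE.
Qed.

Lemma proj_defect_at1 (p : {poly R}) : (size p <= 2 * s)%N -> (proj_defect p).[1] = 0.
Proof.
by move=> sp; rewrite hornerD hornerN primitive_proj_at1 quad_poly // subrr.
Qed.

End Quadrature.

(** * Bounds that are uniform over a family *)

Section UniformBound.
Context {R : realType} {I : Type}.
Implicit Types u v w : I -> R.

(** The index set [I] plays the role of all the choices (step size, solution,
    step number) over which the constant of an estimate has to be uniform. *)
Definition isO u v := exists C, forall i, `|u i| <= C * v i.

Lemma isO_le u v : (forall i, `|u i| <= v i) -> isO u v.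
Proof. by move=> uv; exists 1 => i; rewrite mul1r. Qed.

Lemma isO_norm u v : isO u v -> isO (fun i => `|u i|) v.
Proof. by move=> [C h]; exists C => i; rewrite normr_id. Qed.

Lemma isO_ext u u' v : (forall i, u i = u' i) -> isO u' v -> isO u v.
Proof. by move=> uu' [C uv]; exists C => i; rewrite uu'. Qed.

Lemma isO_trans u v w : isO u v -> isO v w -> isO u w.
Proof.
move=> [C uv] [C' vw]; exists (`|C| * C') => i; apply: (le_trans (uv i)).
apply: le_trans (ler_norm _) _; rewrite normrM -mulrA.
exact: ler_wpM2l.
Qed.

Lemma isO_weak u v w : isO u v -> (forall i, 0 <= v i <= w i) -> isO u w.
Proof.
move=> uv vw; apply: isO_trans uv _; apply: isO_le => i.
by have /andP[v0 ?] := vw i; rewrite ger0_norm.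
Qed.

Lemma isO0 v : isO (fun=> 0) v.
Proof. by exists 0 => i; rewrite normr0 mul0r. Qed.

Lemma isO_cst a : isO (fun=> a) (fun=> 1).
Proof. by exists `|a| => i; rewrite mulr1. Qed.

Lemma isOD u1 u2 v : isO u1 v -> isO u2 v -> isO (fun i => u1 i + u2 i) v.
Proof.
move=> [C1 h1] [C2 h2]; exists (C1 + C2) => i.
by apply: le_trans (ler_normD _ _) _; rewrite mulrDl lerD.
Qed.

Lemma isON u v : isO u v -> isO (fun i => - u i) v.
Proof. by move=> [C h]; exists C => i; rewrite normrN. Qed.

Lemma isOB u1 u2 v : isO u1 v -> isO u2 v -> isO (fun i => u1 i - u2 i) v.
Proof. by move=> h1 h2; apply: isOD => //; apply: isON. Qed.

Lemma isOM u1 u2 v1 v2 : isO u1 v1 -> isO u2 v2 ->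
  isO (fun i => u1 i * u2 i) (fun i => v1 i * v2 i).
Proof.
move=> [C1 h1] [C2 h2]; exists (C1 * C2) => i.
by rewrite normrM mulrACA ler_pM.
Qed.

Lemma isOZ a u v : isO u v -> isO (fun i => a * u i) v.
Proof.
move=> uv; have [C h] := isOM (isO_cst a) uv.
by exists C => i; have := h i; rewrite mul1r.
Qed.

Lemma isOZr a u v : isO u v -> isO (fun i => u i * a) v.
Proof. by move=> uv; apply: isO_ext (isOZ a uv) => i; rewrite mulrC. Qed.

Lemma isO_sum (J : Type) (r : seq J) (p : pred J) (u : J -> I -> R) v :
  (forall j, p j -> isO (u j) v) -> isO (fun i => \sum_(j <- r | p j) u j i) v.
Proof.
move=> uv; elim: r => [|j r IHr].
  by apply: isO_ext (isO0 v) => i; rewrite big_nil.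
have [pj|npj] := boolP (p j).
  by apply: isO_ext (isOD (uv j pj) IHr) => i; rewrite big_cons pj.
by apply: isO_ext IHr => i; rewrite big_cons (negPf npj).
Qed.

Lemma isO_unif (J : finType) (u : J -> I -> R) v : (forall i, 0 <= v i) ->
  (forall j, isO (u j) v) ->
  exists2 C, 0 <= C & forall j i, `|u j i| <= C * v i.
Proof.
move=> v0 /choice[C hC]; exists (\sum_j `|C j|) => [|j i]; first exact: sumr_ge0.
apply: le_trans (hC j i) _; rewrite ler_wpM2r // (bigD1 j) //=.
by apply: le_trans (ler_norm _) _; rewrite lerDl sumr_ge0.
Qed.

Lemma isO_quad k (b c : 'I_k -> R) (u : I -> R -> R) v :
  (forall l, isO (fun i => u i (c l)) v) -> isO (fun i => quad b c (u i)) v.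
Proof. by move=> uv; apply: isO_sum => l _; exact: isOZ. Qed.

End UniformBound.

Lemma horner_bound (R : realType) (p : {poly R}) :
  exists2 C, 0 <= C & forall t, 0 <= t <= 1 -> `|p.[t]| <= C.
Proof.
exists (\sum_(i < size p) `|p`_i|) => [|t /andP[t0 t1]].
  by apply: sumr_ge0 => i _; exact: normr_ge0.
rewrite horner_coef; apply: le_trans (ler_norm_sum _ _ _) _.
apply: ler_sum => i _; rewrite normrM ler_piMr // normrX ger0_norm //.
exact: exprn_ile1.
Qed.

Lemma isO_horner (R : realType) (I : Type) (p : {poly R}) (t : I -> R) :
  (forall i, 0 <= t i <= 1) -> isO (fun i => p.[t i]) (fun=> 1).
Proof.
move=> t01; have [C _ Cp] := horner_bound p.
by exists C => i; rewrite mulr1; exact: Cp.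
Qed.

(** * The error committed in one step *)

Section Step.
Context {R : realType} {k : nat}.
Variables (b c : 'I_k -> R) (s : nat) (P : nat -> {poly R}).
Hypothesis exact_quad : quadrature_order b c (2 * s).
Hypothesis basisP : legendre_basis P.
Hypothesis s_gt0 : (0 < s)%N.
Hypothesis c01 : forall l, 0 <= c l <= 1.

Local Notation quad := (quad b c).
Local Notation proj := (proj b c s P).
Local Notation proj_defect := (proj_defect b c s P).

(** The constant only depends on the method, hence not on the step size. *)
Lemma primitive_proj_bound : exists2 G : R, 0 <= G &
  forall g t, 0 <= t <= 1 ->
    `|(primitive (proj g)).[t]| <= G * \sum_(l < k) `|g (c l)|.
Proof.
have /choice[B HB] (p : 'I_s) : exists B, 0 <= B /\
    forall t, 0 <= t <= 1 -> `|(primitive (P p)).[t]| <= B.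
  by have [B B0 hB] := horner_bound (primitive (P p)); exists B.
pose w (p : 'I_s) l := `|b l| * `|(P p).[c l]|.
exists (\sum_(p < s) \sum_(l < k) w p l * B p) => [|g t t01].
  apply: sumr_ge0 => p _; apply: sumr_ge0 => l _.
  by rewrite !mulr_ge0 //; case: (HB p).
rewrite linear_sum horner_sum mulr_suml.
apply: le_trans (ler_norm_sum _ _ _) (ler_sum _ _) => p _.
rewrite linearZ hornerZ normrM /quad mulr_suml.
have [B0 /(_ t t01) hB] := HB p.
have gS l : `|g (c l)| <= \sum_(l < k) `|g (c l)|.
  by rewrite (bigD1 l) //= lerDl sumr_ge0.
apply: le_trans (ler_wpM2r (normr_ge0 _) (ler_norm_sum _ _ _)) _.
rewrite mulr_suml; apply: ler_sum => l _.
rewrite !normrM -!mulrA; apply: ler_wpM2l => //; apply: ler_wpM2l => //.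
by rewrite mulrC; apply: ler_pM.
Qed.

Section Family.
Context {I : Type}.
Variables (h : I -> R).
Hypothesis h01 : forall i, 0 < h i <= 1.

Lemma h_ge0 i : 0 <= h i.
Proof. by have /andP[/ltW] := h01 i. Qed.

Lemma exph_ge0 n i : 0 <= h i ^+ n.
Proof. exact: exprn_ge0 (h_ge0 i). Qed.

Lemma exph_le m n i : (n <= m)%N -> h i ^+ m <= h i ^+ n.
Proof.
by move=> nm; have /andP[_ h1] := h01 i; apply: ler_wiXn2l => //; exact: h_ge0.
Qed.

Lemma isO_exph n : isO (fun i => h i ^+ n) (fun i => h i ^+ n).
Proof. by apply: isO_le => i; rewrite ger0_norm // exph_ge0. Qed.

Lemma isO_weakh m n (u : I -> R) : (n <= m)%N ->
  isO u (fun i => h i ^+ m) -> isO u (fun i => h i ^+ n).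
Proof.
move=> nm /isO_weak; apply => i; by rewrite exph_ge0 exph_le.
Qed.

Section Defect.
Variables (Q : I -> {poly R}) (D r : I -> R -> R).
Hypothesis sizeQ : forall i, (size (Q i) <= 2 * s)%N.
Hypothesis coefQ : forall n, isO (fun i => (Q i)`_n) (fun i => h i ^+ n).
Hypothesis D_def : forall i (t : R), 0 <= t <= 1 ->
  D i t = h i * (proj_defect (Q i)).[t] + r i t.
Hypothesis r_small : forall t : I -> R, (forall i, 0 <= t i <= 1) ->
  isO (fun i => r i (t i)) (fun i => h i ^+ (2 * s + 1)).

Let proj_defectQ i t :
  (proj_defect (Q i)).[t] = \sum_(n < 2 * s) (Q i)`_n * (proj_defect 'X^n).[t].
Proof.
rewrite {1}(poly_sum_coef (sizeQ i)) linear_sum horner_sum.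
by apply: eq_bigr => n _; rewrite linearZ hornerZ.
Qed.

(** Only the monomials of degree at least [s] contribute. *)
Lemma defect_point (t : I -> R) : (forall i, 0 <= t i <= 1) ->
  isO (fun i => D i (t i)) (fun i => h i ^+ (s + 1)).
Proof.
move=> t01; apply: (isO_ext (u' := fun i =>
  h i * (proj_defect (Q i)).[t i] + r i (t i))) => [i|]; first exact: D_def.
apply: isOD; last by apply: isO_weakh (r_small t01); lia.
apply: (isO_ext (u' := fun i =>
  \sum_(n < 2 * s) h i * ((Q i)`_n * (proj_defect 'X^n).[t i]))) => [i|].
  by rewrite proj_defectQ mulr_sumr.
apply: isO_sum => n _; have [lt_ns|le_sn] := ltnP n s.
  apply: isO_ext (isO0 _) => i; rewrite (proj_defect_low exact_quad) //.
    by rewrite horner0 !mulr0.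
  by rewrite size_polyXn.
apply: (isO_weakh (m := n.+1)); first lia.
have := isOM (isO_exph 1) (isOM (coefQ n) (isO_horner (proj_defect 'X^n) t01)).
move/isO_weak; apply => i.
by rewrite mulr1 expr1 -exprS exph_ge0 lexx.
Qed.

(** Only the monomials of degree at least [2 * s - n - 1] contribute, by
    [proj_defect_moment], and their coefficients are as small as required. *)
Lemma defect_moment n : (n + 2 <= s)%N ->
  isO (fun i => h i ^+ n * quad (fun x => (1 - x) ^+ n * D i x))
      (fun i => h i ^+ (2 * s)).
Proof.
move=> ns; have cl01 l : forall _ : I, 0 <= c l <= 1 by [].
apply: (isO_ext (u' := fun i =>
  \sum_(j < 2 * s) h i ^+ n.+1 * ((Q i)`_j *
      quad (fun x => (1 - x) ^+ n * (proj_defect 'X^j).[x])) +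
  h i ^+ n * quad (fun x => (1 - x) ^+ n * r i x))) => [i|].
  rewrite -mulr_sumr; under eq_bigr do rewrite -quadZ.
  rewrite -quad_sum exprSr -mulrA -mulrDr; congr (_ * _); rewrite -quadZ -quadD.
  apply: eq_bigr => l _; rewrite D_def // proj_defectQ mulrDr; congr (_ * (_ + _)).
  rewrite mulrCA mulr_sumr; congr (_ * _).
  by apply: eq_bigr => j _; rewrite mulrCA.
apply: isOD; last first.
  apply: isO_weak (isOM (isO_exph n) (isO_quad b (c := c)
    (v := fun i => h i ^+ (2 * s + 1)) _)) _ => [l|i].
    exact/isOZ/(r_small (cl01 l)).
  by rewrite -exprD exph_ge0 exph_le //; lia.
apply: isO_sum => j _; have [lt_js|le_sj] := ltnP (j + n + 1) (2 * s).
  apply: isO_ext (isO0 _) => i.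
  rewrite (proj_defect_moment exact_quad) ?mulr0 // size_polyXn.
  by case: j lt_js => j ? /=; lia.
apply: (isO_weakh (m := n.+1 + j)); first by case: j le_sj => j ? /=; lia.
have := isOM (isO_exph n.+1) (isOZr (quad (fun x => (1 - x) ^+ n *
  (proj_defect 'X^j).[x])) (coefQ j)).
by move/isO_weak; apply => i; rewrite -exprD exph_ge0 lexx.
Qed.

Lemma defect_end : isO (fun i => D i 1) (fun i => h i ^+ (2 * s + 1)).
Proof.
have i01 (i : I) : 0 <= (1 : R) <= 1 by rewrite ler01 lexx.
apply: isO_ext (r_small i01) => i.
by rewrite D_def ?(proj_defect_at1 exact_quad basisP) ?i01 // mulr0 add0r.
Qed.

End Defect.

(** [eta] collects the components of the error of the current step (index
    [inl]) and those of the delayed error (index [inr]), because the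
    linearization [g_linear] treats them alike.  [x] measures the error at the
    beginning of the step, and [A] the Jacobian matrix of the field along the
    exact solution, with coefficients [al] in its expansion at the end of the
    step. *)
Section Error.
Variables (J J' : finType).
Local Notation V := (J + J')%type.
Variables (x : I -> R) (e0 : I -> J -> R) (eta : I -> V -> R -> R).
Variables (D g : I -> J -> R -> R) (L : R).
Variables (A : I -> J -> V -> R -> R) (al : I -> J -> V -> nat -> R).

Local Notation X := (fun i => x i + h i ^+ (2 * s)).
Local Notation Y := (fun i => x i + h i ^+ (s + 1)).
Local Notation moment i n v := (h i ^+ n * quad (fun t => (1 - t) ^+ n * eta i v t)).

Hypothesis x01 : forall i, 0 <= x i <= 1.
Hypothesis e0_le : forall i j, `|e0 i j| <= x i.
Hypothesis error_eq : forall i j (t : R), 0 <= t <= 1 ->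
  eta i (inl j) t = e0 i j + D i j t + h i * (primitive (proj (g i j))).[t].
Hypothesis D_point : forall j (t : I -> R), (forall i, 0 <= t i <= 1) ->
  isO (fun i => D i j (t i)) (fun i => h i ^+ (s + 1)).
Hypothesis D_moment : forall j n, (n + 2 <= s)%N ->
  isO (fun i => h i ^+ n * quad (fun t => (1 - t) ^+ n * D i j t))
      (fun i => h i ^+ (2 * s)).
Hypothesis D_end : forall j, isO (fun i => D i j 1) (fun i => h i ^+ (2 * s + 1)).
Hypothesis delay_node : forall j l,
  isO (fun i => eta i (inr j) (c l)) (fun i => h i ^+ (s + 1)).
Hypothesis delay_moment : forall j n, (n + 2 <= s)%N ->
  isO (fun i => moment i n (inr j)) (fun i => h i ^+ (2 * s)).
Hypothesis g_lipschitz : forall i j l,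
  `|g i j (c l)| <= L * \sum_v `|eta i v (c l)|.
Hypothesis L_ge0 : 0 <= L.
Hypothesis g_linear : forall j l,
  isO (fun i => g i j (c l) - \sum_v A i j v (c l) * eta i v (c l))
      (fun i => (\sum_v `|eta i v (c l)|) ^+ 2).
Hypothesis al_small : forall j v n,
  isO (fun i => al i j v n) (fun i => h i ^+ n).
Hypothesis A_taylor : forall j v l,
  isO (fun i => A i j v (c l) - \sum_(n < s) al i j v n * (1 - c l) ^+ n)
      (fun i => h i ^+ s).

Lemma X_ge0 i : 0 <= x i + h i ^+ (2 * s).
Proof. by rewrite addr_ge0 ?exph_ge0 //; case/andP: (x01 i). Qed.

Lemma Y_ge0 i : 0 <= x i + h i ^+ (s + 1).
Proof. by rewrite addr_ge0 ?exph_ge0 //; case/andP: (x01 i). Qed.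

Lemma x_ge0 i : 0 <= x i. Proof. by case/andP: (x01 i). Qed.

(** The implicit equation for the error at the nodes is a contraction as soon as
    the step is small compared to the Lipschitz constant. *)
Lemma error_node (G : R) : 0 <= G ->
  (forall g t, 0 <= t <= 1 ->
    `|(primitive (proj g)).[t]| <= G * \sum_(l < k) `|g (c l)|) ->
  (forall i, h i * (2 * (k%:R * #|J|%:R * G * L)) <= 1) ->
  forall v l, isO (fun i => eta i v (c l)) Y.
Proof.
move=> G0 hG hsmall [j|j] l; last first.
  apply: isO_weak (delay_node _ _) _ => i.
  by rewrite exph_ge0 lerDr x_ge0.
pose S i : R := \sum_(l < k) \sum_j (x i + `|D i j (c l)|).
pose F i : R := \sum_(l < k) \sum_j `|eta i (inr j) (c l)|.
pose E i : R := \sum_(l < k) \sum_j `|eta i (inl j) (c l)|.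
have cl01 l' : forall _ : I, 0 <= c l' <= 1 by [].
have E_S i : E i <= S i + h i * ((k%:R * #|J|%:R * G * L) * (E i + F i)).
  have gEF j' : \sum_(l < k) `|g i j' (c l)| <= L * (E i + F i).
    rewrite /E /F -big_split /= mulr_sumr; apply: ler_sum => l' _.
    by apply: le_trans (g_lipschitz _ _ _) _; rewrite big_sumType.
  have -> : k%:R * #|J|%:R * G * L * (E i + F i) =
      \sum_(l < k) \sum_(j' : J) G * (L * (E i + F i)).
    rewrite !sumr_const !card_ord; ring.
  set W := G * _; rewrite /E /S mulr_sumr -big_split /=; apply: ler_sum => l' _.
  rewrite mulr_sumr -big_split /=; apply: ler_sum => j' _.
  rewrite error_eq //; apply: le_trans (ler_normD _ _) _.
  apply: lerD; first by apply: le_trans (ler_normD _ _) _; rewrite lerD2r.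
  rewrite normrM (ger0_norm (h_ge0 i)) ler_wpM2l ?h_ge0 //.
  by apply: le_trans (hG _ _ (c01 l')) _; rewrite /W ler_wpM2l.
have E0 i : 0 <= E i by do 2 (apply: sumr_ge0 => ? _).
have F0 i : 0 <= F i by do 2 (apply: sumr_ge0 => ? _).
have EF i : `|eta i (inl j) (c l)| <= 2 * S i + F i.
  have : E i <= 2 * S i + F i.
    have := E_S i; have := hsmall i.
    set K := _ * L => hK; rewrite mulrA => hE.
    have : h i * K * (E i + F i) <= 2^-1 * (E i + F i).
      by rewrite ler_wpM2r ?addr_ge0 //; lra.
    by lra.
  apply: le_trans; rewrite /E (bigD1 l) //= (bigD1 j) //= -addrA lerDl.
  by rewrite addr_ge0 //; apply: sumr_ge0 => ? _ //; apply: sumr_ge0.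
apply: isO_trans (isO_le EF) _; apply: isOD.
  apply: isOZ; apply: isO_sum => l' _; apply: isO_sum => j' _; apply: isOD.
    apply: isO_le => i; rewrite ger0_norm ?x_ge0 // lerDl; exact: exph_ge0.
  apply: isO_weak (isO_norm (D_point j' (cl01 l'))) _ => i.
  by rewrite exph_ge0 lerDr x_ge0.
apply: isO_sum => l' _; apply: isO_sum => j' _.
apply: isO_weak (isO_norm (delay_node j' l')) _ => i.
by rewrite exph_ge0 lerDr x_ge0.
Qed.

Hypothesis eta_node : forall v l, isO (fun i => eta i v (c l)) Y.

Lemma eta_sum_node l : isO (fun i => \sum_v `|eta i v (c l)|) Y.
Proof.
by apply: isO_sum => v _; exact: isO_norm.
Qed.

Lemma g_node j l : isO (fun i => g i j (c l)) Y.
Proof.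
have [C hC] := eta_sum_node l.
exists (L * C) => i; apply: le_trans (g_lipschitz _ _ _) _.
rewrite -mulrA ler_wpM2l //; apply: le_trans (hC i); exact: ler_norm.
Qed.

Lemma error_point j (t : I -> R) : (forall i, 0 <= t i <= 1) ->
  isO (fun i => eta i (inl j) (t i)) Y.
Proof.
move=> t01; apply: (isO_ext (fun i => error_eq i j (t01 i))).
apply: isOD; first apply: isOD.
- apply: isO_le => i; apply: le_trans (e0_le i j) _.
  by rewrite lerDl exph_ge0.
- apply: isO_weak (D_point j t01) _ => i.
  by rewrite exph_ge0 lerDr x_ge0.
- apply: (isO_ext (u' := fun i => \sum_(p < s) h i *
    (quad (fun t => (P p).[t] * g i j t) * (primitive (P p)).[t i]))) => [i|].
    rewrite linear_sum horner_sum mulr_sumr; apply: eq_bigr => p _.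
    by rewrite linearZ hornerZ.
  apply: isO_sum => p _; apply: isO_weak (isOM (isO_exph 1) (isOM
    (isO_quad b (fun l => isOZ (P p).[c l] (g_node j l)))
    (isO_horner (primitive (P p)) t01))) _ => i.
  rewrite mulr1 mulr_ge0 ?exph_ge0 ?Y_ge0 //= ler_piMl ?Y_ge0 // expr1.
  by case/andP: (h01 i).
Qed.

Lemma pow_Y_le_X n i : (s <= n + 1)%N -> 0 <= h i ^+ n * (x i + h i ^+ (s + 1)) <=
  x i + h i ^+ (2 * s).
Proof.
move=> sn; rewrite mulr_ge0 ?exph_ge0 ?Y_ge0 //= mulrDr lerD //.
  by rewrite ler_piMl ?x_ge0 // -(expr0 (h i)) exph_le.
by rewrite -exprD exph_le //; lia.
Qed.

(** From order [s - 1] on, the size of the error is enough. *)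
Lemma moment_high n v : (s <= n + 1)%N -> isO (fun i => moment i n v) X.
Proof.
move=> sn; apply: isO_weak (isOM (isO_exph n)
  (isO_quad b (fun l => isOZ ((1 - c l) ^+ n) (eta_node v l)))) _ => i.
exact: pow_Y_le_X.
Qed.

(** The coefficient [al i j v l] of [(1 - t) ^ l] in the Jacobian compensates the
    factor [h ^ l] that separates the moments of orders [n] and [n + l]. *)
Lemma g_moment j n :
  (forall n' v, (n <= n')%N -> isO (fun i => moment i n' v) X) ->
  isO (fun i => h i ^+ n * quad (fun t => (1 - t) ^+ n * g i j t)) X.
Proof.
move=> hmom.
pose gl i t := \sum_v A i j v t * eta i v t.
pose Ar i v t := A i j v t - \sum_(n < s) al i j v n * (1 - t) ^+ n.
apply: (isO_ext (u' := fun i =>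
  \sum_v (\sum_(p < s) al i j v p * h i ^+ n *
            quad (fun t => (1 - t) ^+ (n + p) * eta i v t) +
          h i ^+ n * quad (fun t => (1 - t) ^+ n * (Ar i v t * eta i v t))) +
  h i ^+ n * quad (fun t => (1 - t) ^+ n * (g i j t - gl i t)))) => [i|].
  rewrite big_split /= -mulr_sumr -quad_sum.
  under eq_bigr => v _ do under eq_bigr => p _ do rewrite mulrAC mulrC -quadZ.
  under eq_bigr => v _ do rewrite -mulr_sumr -quad_sum.
  rewrite -mulr_sumr -quad_sum -!mulrDr -!quadD; congr (_ * _).
  apply: eq_quad => t; rewrite mulrBr -big_split /= addrCA.
  rewrite -[LHS]addr0; congr (_ + _); apply: esym.
  apply/eqP; rewrite subr_eq0; apply/eqP; rewrite /gl mulr_sumr; apply: eq_bigr => v _.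
  rewrite /Ar mulrBl mulrBr [X in X + _](_ : _ =
    (1 - t) ^+ n * ((\sum_(p < s) al i j v p * (1 - t) ^+ p) * eta i v t)).
    by rewrite addrC subrK.
  rewrite mulr_suml mulr_sumr; apply: eq_bigr => p _.
  by rewrite exprD; ring.
apply: isOD; last first.
  apply: isO_trans (isOM (isO_exph n) (isO_quad b
    (v := fun i => (x i + h i ^+ (s + 1)) ^+ 2) (fun l => isOZ _ _))) _ => [l|].
    apply: isO_trans (g_linear j l) _.
    by have := isOM (eta_sum_node l) (eta_sum_node l).
  exists 3 => i; rewrite ger0_norm ?mulr_ge0 ?exph_ge0 ?exprn_ge0 ?Y_ge0 //.
  have := exph_ge0 (s + 1) i.
  have := exph_le i (leq0n (s + 1)); rewrite expr0.
  have : h i ^+ (s + 1) * h i ^+ (s + 1) <= h i ^+ (2 * s).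
    by rewrite -exprD exph_le //; lia.
  move: (_ ^+ (s + 1)) => p pq p1 p0.
  have hn1 : h i ^+ n <= 1 by rewrite -(expr0 (h i)) exph_le.
  apply: le_trans (ler_wpM2r _ hn1) _; first by rewrite exprn_ge0 // addr_ge0 ?x_ge0.
  have /andP[x0 x1] := x01 i; rewrite mul1r.
  have : x i * x i <= x i by rewrite ler_piMr.
  have : x i * p <= x i by rewrite ler_piMr.
  by have := exph_ge0 (2 * s) i; rewrite expr2; lra.
apply: isO_sum => v _; apply: isOD.
  apply: isO_sum => p _; apply: isO_trans (isO_norm (hmom (n + p)%N v (leq_addr _ _))).
  have [C hC] := al_small j v p; exists C => i.
  rewrite !normrM exprD normrM (ger0_norm (exph_ge0 p i)) !mulrA.
  by rewrite ler_wpM2r // [leRHS]mulrAC ler_wpM2r.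
apply: isO_weak (isOM (isO_exph n) (isO_quad b
    (fun l => isOZ ((1 - c l) ^+ n) (isOM (A_taylor j v l) (eta_node v l))))) _ => i.
rewrite mulrA -exprD; apply: pow_Y_le_X; lia.
Qed.

(** Downward induction on the order [n]: by [quad_primitive_proj], the moment of
    order [n] of the error is determined by the moment of order [n.+1] of [g]. *)
Lemma moment_small n v : isO (fun i => moment i n v) X.
Proof.
have [m] := ubnP (s - n); elim: m => // m IHm in n v *; rewrite ltnS => snm.
have [sn|ns] := leqP s (n + 1); first exact: moment_high.
case: v => [j|j]; last first.
  apply: isO_weak (delay_moment j (n := n) _) _ => [|i]; first by lia.
  by rewrite exph_ge0 lerDr x_ge0.
apply: (isO_ext (u' := fun i =>
   e0 i j * (h i ^+ n * quad (fun t => (1 - t) ^+ n)) +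
   h i ^+ n * quad (fun t => (1 - t) ^+ n * D i j t) +
   h i ^+ n.+1 * quad (fun t => (1 - t) ^+ n.+1 * g i j t) / n.+1%:R)) => [i|].
  rewrite exprSr -!mulrA -(quad_primitive_proj exact_quad basisP); last lia.
  rewrite mulrCA -!mulrDr; congr (_ * _); rewrite -!quadZ -!quadD.
  apply: eq_bigr => l _.
  by rewrite error_eq //; congr (_ * _); ring.
apply: isOD; first apply: isOD.
- apply: isO_weak (isOM (isO_le (fun i => e0_le i j)) (isOM (isO_exph n)
    (isO_cst _))) _ => i.
  rewrite mulr1 mulr_ge0 ?x_ge0 ?exph_ge0 //=.
  apply: (@le_trans _ _ (x i)); last by rewrite lerDl exph_ge0.
  by rewrite ler_piMr ?x_ge0 // -(expr0 (h i)) exph_le.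
- apply: isO_weak (D_moment j _) _ => [|i]; first lia.
  by rewrite exph_ge0 lerDr x_ge0.
- apply: isOZr; apply: g_moment => n' v nn'; apply: IHm; lia.
Qed.

(** At the end of the step the primitive of the projection is the quadrature of
    [g], that is, its moment of order 0. *)
Lemma error_end j :
  isO (fun i => eta i (inl j) 1 - e0 i j) (fun i => h i * (x i + h i ^+ (2 * s))).
Proof.
have i01 (i : I) : 0 <= (1 : R) <= 1 by rewrite ler01 lexx.
apply: (isO_ext (u' := fun i => D i j 1 + h i * quad (g i j))) => [i|].
  rewrite error_eq ?i01 // (primitive_proj_at1 exact_quad basisP) //; ring.
apply: isOD.
  apply: isO_weak (D_end j) _ => i; rewrite exph_ge0 addn1 exprS ler_wpM2l ?h_ge0 //.
  by rewrite lerDr x_ge0.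
have g0 : isO (fun i => quad (g i j)) X.
  apply: isO_ext (g_moment (n := 0) j (fun n v _ => moment_small n v)) => i.
  by rewrite mul1r; apply: eq_quad => t; rewrite mul1r.
apply: isO_weak (isOM (isO_exph 1) g0) _ => i.
by rewrite expr1 lexx mulr_ge0 ?h_ge0 ?X_ge0.
Qed.

End Error.
End Family.
End Step.

(** * Derivatives of curves *)

Section Curves.
Context {R : realType}.

Lemma is_derive_comp_curve (V W : normedModType R) (F : V -> W) (z : R -> V)
    (t : R) dz :
  differentiable F (z t) -> is_derive t 1 z dz ->
  is_derive t 1 (fun u => F (z u)) ('d F (z t) dz).
Proof.
move=> dF Dz; have dz' : differentiable z t by apply/derivable1_diffP; case: Dz.
have dFz : differentiable (F \o z) t by exact: differentiable_comp.
apply: DeriveDef; first exact/derivable1_diffP.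
rewrite deriveE // diff_comp //=; congr ('d F (z t) _).
by rewrite -deriveE //; case: Dz.
Qed.

Lemma is_derive_coord n (z : R -> 'rV[R]_n) (t : R) dz j :
  is_derive t 1 z dz -> is_derive t 1 (fun u => z u 0 j) (dz 0 j).
Proof.
case=> Dz <-; apply: DeriveDef; first exact: (derivable_mxP _ _ _).1.
by rewrite derive_mx // mxE.
Qed.

Lemma is_derive_row n (z : R -> 'rV[R]_n) (t : R) (dz : 'I_n -> R) :
  (forall j, is_derive t 1 (fun u => z u 0 j) (dz j)) ->
  is_derive t 1 z (\row_j dz j).
Proof.
move=> Dz; have dz' : derivable z t 1.
  by apply/derivable_mxP => i j; rewrite ord1; case: (Dz j).
apply: DeriveDef => //; rewrite derive_mx //; apply/rowP => j; rewrite !mxE.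
by case: (Dz j).
Qed.

Lemma is_derive_pair (V W : normedModType R) (y : R -> V) (w : R -> W) (t : R)
    dy dw :
  is_derive t 1 y dy -> is_derive t 1 w dw ->
  is_derive t 1 (fun u => (y u, w u)) (dy, dw).
Proof.
move=> [Dy <-] [Dw <-].
have dy' : differentiable y t by exact/derivable1_diffP.
have dw' : differentiable w t by exact/derivable1_diffP.
have dyw : differentiable (fun u => (y u, w u)) t by exact: differentiable_pair.
apply: DeriveDef; first exact/derivable1_diffP.
by rewrite deriveE // diff_pair //= !deriveE.
Qed.

End Curves.

(** * Smooth functions on an interval and their Taylor expansions *)

Section SmoothOn.
Context {R : realType}.
Implicit Types (a b : R) (g : R -> R).

(** Scalar functions of class C^k on a closed interval, in the inductive form
    that suits the proofs of the stability properties. *)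
Fixpoint smooth_on k a b g : Prop :=
  {within `[a, b], continuous g} /\
  if k is k'.+1 then
    exists2 g', smooth_on k' a b g' &
      forall x, a < x < b -> is_derive x 1 g (g' x)
  else True.

Lemma smooth_on_continuous k a b g :
  smooth_on k a b g -> {within `[a, b], continuous g}.
Proof. by case: k => [|k] []. Qed.

Lemma smooth_onS k a b g : smooth_on k.+1 a b g -> smooth_on k a b g.
Proof.
elim: k g => [|k IHk] g [cg [g' sg' dg]]; first by split.
by split=> //; exists g' => //; exact: IHk.
Qed.

Lemma smooth_on_le k l a b g : (l <= k)%N -> smooth_on k a b g -> smooth_on l a b g.
Proof.
move=> /subnK <-; elim: (k - l)%N => // n IHn; rewrite addSn => /smooth_onS.
exact: IHn.
Qed.

Lemma smooth_on_cst k a b (r : R) : smooth_on k a b (fun=> r).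
Proof.
elim: k r => [|k IHk] r; split=> //;
  try by apply: continuous_subspaceT => ?; exact: cvg_cst.
by exists (fun=> 0) => // x _; exact: is_derive_cst.
Qed.

Lemma smooth_onD k a b g1 g2 : smooth_on k a b g1 -> smooth_on k a b g2 ->
  smooth_on k a b (fun x => g1 x + g2 x).
Proof.
elim: k g1 g2 => [|k IHk] g1 g2 [c1 H1] [c2 H2]; split=> //;
  try by move=> x; apply: cvgD; [exact: c1|exact: c2].
case: H1 H2 => [d1 s1 D1] [d2 s2 D2]; exists (fun x => d1 x + d2 x).
  exact: IHk.
by move=> x xab; apply: is_deriveD; [exact: D1|exact: D2].
Qed.

Lemma smooth_onM k a b g1 g2 : smooth_on k a b g1 -> smooth_on k a b g2 ->
  smooth_on k a b (fun x => g1 x * g2 x).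
Proof.
elim: k g1 g2 => [|k IHk] g1 g2 S1 S2; have [c1 H1] := S1; have [c2 H2] := S2;
  split=> //; try by move=> x; apply: cvgM; [exact: c1|exact: c2].
case: H1 H2 => [d1 s1 D1] [d2 s2 D2]; exists (fun x => g1 x * d2 x + g2 x * d1 x).
  by apply: smooth_onD; apply: IHk => //; exact: smooth_onS.
by move=> x xab; apply: is_deriveM; [exact: D1|exact: D2].
Qed.

Lemma smooth_on_sum k a b (J : Type) (r : seq J) (G : J -> R -> R) :
  (forall j, smooth_on k a b (G j)) ->
  smooth_on k a b (fun x => \sum_(j <- r) G j x).
Proof.
move=> sG; elim: r => [|j r IHr].
  by under eq_fun do rewrite big_nil; exact: smooth_on_cst.
by under eq_fun do rewrite big_cons; exact: smooth_onD.
Qed.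

Lemma within_continuous_shift (W : topologicalType) a b d (g : R -> W) :
  {within `[a, b], continuous g} ->
  {within `[a + d, b + d], continuous (fun t => g (t - d))}.
Proof.
move=> /subspace_continuousP cg; apply/subspace_continuousP => x xab.
have x'ab : `[a, b]%classic (x - d).
  by move: xab; rewrite /= !in_itv /=; lra.
apply: cvg_trans (cg _ x'ab) => /= U [e /= e0 He].
exists e => //= u xu uab; apply: (He (u - d)).
  by rewrite /ball_ /= (_ : x - d - (u - d) = x - u) //; ring.
by move: uab; rewrite /= !in_itv /=; lra.
Qed.

Lemma is_derive_shift_comp g (x d l : R) :
  is_derive (x - d) 1 g l -> is_derive x 1 (fun t => g (t - d)) l.
Proof.
move=> Dg; have dg : differentiable g (x - d).
  by apply/derivable1_diffP; case: Dg.
have := @is_derive_comp_curve _ _ _ g (center d) x 1 dg (is_derive_shift x 1 (- d)).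
rewrite -deriveE //; by case: Dg => _ ->.
Qed.

Lemma smooth_on_shift k a b d g : smooth_on k a b g ->
  smooth_on k (a + d) (b + d) (fun t => g (t - d)).
Proof.
elim: k g => [|k IHk] g [cg Hg]; split=> //; try exact: within_continuous_shift.
case: Hg => g' sg' dg; exists (fun t => g' (t - d)); first exact: IHk.
by move=> x xab; apply: is_derive_shift_comp; apply: dg; lra.
Qed.

(** The expansion polynomials are a function [tp] of the base point, so that
    they can be used as they are in families of estimates; a single constant
    bounds their coefficients and the remainders. *)
Definition taylor k a b g (C : R) (tp : R -> {poly R}) :=
  forall x0, a <= x0 <= b ->
    [/\ (size (tp x0) <= k)%N, forall l, `|(tp x0)`_l| <= C &
        forall x, a <= x <= b -> `|g x - (tp x0).[x - x0]| <= C * `|x - x0| ^+ k].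

(** Integrating an expansion raises its order by one; this is the mean value
    theorem applied to the remainder. *)
Lemma taylor_primitive k a b g g' C tp : taylor k a b g' C tp ->
  {within `[a, b], continuous g} ->
  (forall x, a < x < b -> is_derive x 1 g (g' x)) ->
  forall x0 x, a <= x0 <= b -> a <= x <= b ->
    `|g x - g x0 - (primitive (tp x0)).[x - x0]| <= C * `|x - x0| ^+ k.+1.
Proof.
move=> T cg dg x0 x x0ab xab; have [sz cf E] := T _ x0ab.
have C0 : 0 <= C by exact: le_trans (normr_ge0 _) (cf 0%N).
pose phi u := g u - (primitive (tp x0)).[u - x0].
pose phi' u := g' u - (tp x0).[u - x0].
have dtp (u : R) : is_derive u 1 (fun u =>
     (primitive (tp x0)).[u - x0]) (tp x0).[u - x0].
  apply: is_derive_shift_comp; have := is_derive_poly (primitive (tp x0)) (u - x0).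
  by rewrite deriv_primitive.
have dphi (u : R) : a < u < b -> is_derive u 1 phi (phi' u).
  by move=> uab; apply: is_deriveB; exact: dg.
have cphi u v : a <= u -> v <= b -> {within `[u, v], continuous phi}.
  move=> au vb x'; apply: cvgB.
    move: x'; apply: continuous_subspaceW cg => y; rewrite /= !in_itv /=; lra.
  move: x'; apply: continuous_subspaceT => y.
  by apply: differentiable_continuous; apply/derivable1_diffP; case: (dtp y).
have mvt u v : a <= u -> u <= v -> v <= b ->
    exists2 xi, u <= xi <= v & phi v - phi u = phi' xi * (v - u).
  move=> au uv vb.
  have D xi : xi \in `]u, v[%R -> is_derive xi 1 phi (phi' xi).
    by rewrite in_itv /= => /andP[? ?]; apply: dphi; lra.
  by have [xi] := MVT_segment uv D (cphi _ _ au vb); rewrite in_itv; exists xi.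
have -> : g x - g x0 - (primitive (tp x0)).[x - x0] = phi x - phi x0.
  by rewrite /phi subrr primitive_at0; ring.
have key xi : a <= xi <= b -> `|xi - x0| <= `|x - x0| ->
    `|phi' xi * (x - x0)| <= C * `|x - x0| ^+ k.+1.
  move=> xiab le_xi; rewrite normrM exprSr mulrA ler_wpM2r //.
  by apply: le_trans (E _ xiab) _; rewrite ler_wpM2l // lerXn2r ?nnegrE.
have [le_x0x|lt_xx0] := leP x0 x.
  have [||xi /andP[? ?] ->] := mvt x0 x _ le_x0x; try lra.
  by apply: key; [lra|rewrite !ger0_norm; lra].
have [||xi /andP[? ?] e] := mvt x x0 _ (ltW lt_xx0); try lra.
have -> : phi x - phi x0 = phi' xi * (x - x0) by rewrite -opprB e; ring.
by apply: key; [lra|rewrite !ler0_norm; lra].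
Qed.

Lemma smooth_on_taylor k a b g : smooth_on k a b g ->
  exists C tp, taylor k a b g C tp.
Proof.
elim: k g => [|k IHk] g [cg Hg].
  have /compact_bounded[M [_ HM]] := continuous_compact cg (@segment_compact _ a b).
  exists (`|M| + 1), (fun=> 0) => x0 _; rewrite size_poly0; split=> // [l|x xab].
    by rewrite coef0 normr0 addr_ge0.
  rewrite horner0 subr0 expr0 mulr1; apply: HM.
    by apply: le_lt_trans (ler_norm M) _; rewrite ltrDl.
  by exists x => //; rewrite /= in_itv.
case: Hg => g' /IHk[C [tp T]] dg.
have /compact_bounded[M [_ HM]] := continuous_compact cg (@segment_compact _ a b).
exists (`|M| + 1 + C), (fun x0 => (g x0)%:P + primitive (tp x0)) => x0 x0ab.
have [sz cf E] := T _ x0ab.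
have C0 : 0 <= C by exact: le_trans (normr_ge0 _) (cf 0%N).
split=> [|l|x xab].
- apply: leq_trans (size_polyD _ _) _; rewrite geq_max.
  rewrite (leq_trans (size_polyC_leq1 _)) //=.
  by apply: leq_trans (size_primitive _) _.
- rewrite coefD coefC coef_primitive; case: l => [|l] /=.
    rewrite invr0 mulr0 addr0; apply: le_trans (_ : `|M| + 1 <= _); last by rewrite lerDl.
    apply: HM; first by apply: le_lt_trans (ler_norm M) _; rewrite ltrDl.
    by exists x0 => //; rewrite /= in_itv.
  rewrite add0r normrM [`|_^-1|]ger0_norm ?invr_ge0 //.
  apply: le_trans (_ : `|(tp x0)`_l| <= _).
    by rewrite ler_piMr // invf_le1 // ler1n.
  by apply: le_trans (cf l) _; rewrite lerDr addr_ge0.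
- rewrite hornerD hornerC opprD addrA.
  apply: le_trans (taylor_primitive T cg dg x0ab xab) _.
  by rewrite ler_wpM2r ?exprn_ge0 // lerDr addr_ge0.
Qed.

End SmoothOn.

Lemma within_continuous_post (R : realType) (V W : topologicalType) (A : set R)
    (z : R -> V) (g : V -> W) :
  {within A, continuous z} -> continuous g ->
  {within A, continuous (fun t => g (z t))}.
Proof.
by move=> cz cg x; exact: (@continuous_comp (subspace A) V W z g x (@cz x) (cg _)).
Qed.

Lemma within_continuous_coord (R : realType) n (A : set R) (z : R -> 'rV[R]_n) j :
  {within A, continuous z} -> {within A, continuous (fun t => z t 0 j)}.
Proof.
move=> /(@within_continuous_post R _ R A z (fun u => u 0 j)); apply.
exact: coord_continuous.
Qed.

(** * Smooth maps of a pair of vectors *)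

Section Pairs.
Context {R : realType} {m : nat}.
Local Notation E := ('rV[R]_m * 'rV[R]_m)%type.
Implicit Types (X : E) (z : R -> E).

Definition pair_coord X (v : 'I_m + 'I_m) : R :=
  match v with inl j => X.1 0 j | inr j => X.2 0 j end.

Definition pair_basis (v : 'I_m + 'I_m) : E :=
  match v with inl j => (delta_mx 0 j, 0) | inr j => (0, delta_mx 0 j) end.

Lemma pair_decomp X : X = \sum_v pair_coord X v *: pair_basis v.
Proof.
case: X => [x1 x2]; rewrite big_sumType /=.
have sum1 (F : 'I_m -> 'rV[R]_m) : \sum_j (F j, 0 : 'rV[R]_m) = (\sum_j F j, 0) :> E.
  by elim/big_rec2: _ => // j a1 a2 _ ->; rewrite -[LHS]/(_ + _, _ + _) addr0.
have sum2 (F : 'I_m -> 'rV[R]_m) : \sum_j (0 : 'rV[R]_m, F j) = (0, \sum_j F j) :> E.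
  by elim/big_rec2: _ => // j a1 a2 _ ->; rewrite -[LHS]/(_ + _, _ + _) addr0.
under eq_bigr do rewrite -[_ *: _]/(_ *: _, _ *: _) scaler0.
under [X in _ = _ + X]eq_bigr do rewrite -[_ *: _]/(_ *: _, _ *: _) scaler0.
rewrite sum1 sum2 -[RHS]/(_ + _, _ + _) addr0 add0r.
by congr (_, _); exact: row_sum_delta.
Qed.

Lemma diff_decomp (W : normedModType R) (F : E -> W) X Y :
  'd F X Y = \sum_v pair_coord Y v *: 'd F X (pair_basis v).
Proof.
rewrite {1}(pair_decomp Y) linear_sum; apply: eq_bigr => v _; exact: linearZ.
Qed.

Lemma class_C_continuous (W : normedModType R) r (F : E -> W) :
  class_C r F -> continuous F.
Proof. by case: r => [|r] //= [dF _] X; exact: differentiable_continuous. Qed.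

Lemma class_CS (W : normedModType R) r (F : E -> W) : class_C r.+1 F -> class_C r F.
Proof.
elim: r F => [|r IHr] F; first exact: class_C_continuous.
by move=> [dF CF]; split=> // v; apply: IHr; exact: CF.
Qed.

Lemma class_C_le (W : normedModType R) r r' (F : E -> W) : (r' <= r)%N ->
  class_C r F -> class_C r' F.
Proof.
by move=> /subnK <-; elim: (r - r')%N => // n IHn; rewrite addSn => /class_CS /IHn.
Qed.

(** The chain rule expresses the derivative through maps [X |-> 'd F X v] with a
    fixed [v], which are the maps that the definition of [class_C] controls. *)
Lemma smooth_on_comp n k (a b : R) (F : E -> 'rV[R]_n) z i :
  class_C k F -> {within `[a, b], continuous z} ->
  (forall v, smooth_on k a b (fun t => pair_coord (z t) v)) ->
  smooth_on k a b (fun t => F (z t) 0 i).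
Proof.
have cont (G : E -> 'rV[R]_n) : continuous G -> {within `[a, b], continuous z} ->
    {within `[a, b], continuous (fun t => G (z t) 0 i)}.
  by move=> cG cz; apply: within_continuous_coord; exact: within_continuous_post cG.
elim: k F => [|k IHk] F CF cz sz; split=> //;
  try by apply: cont => //; exact: class_C_continuous CF.
have [dF dCF] := CF.
have /choice[dz hdz] v : exists g', smooth_on k a b g' /\
    forall x, a < x < b -> is_derive x 1 (fun t => pair_coord (z t) v) (g' x).
  by have [_ [g' sg' dg']] := sz v; exists g'.
exists (fun t => \sum_v dz v t * ('d F (z t) (pair_basis v) 0 i)).
  apply: smooth_on_sum => v; apply: smooth_onM; first by case: (hdz v).
  apply: (IHk (fun X => 'd F X (pair_basis v)) (dCF _) cz) => v'.
  by apply: smooth_onS; exact: sz.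
move=> x xab.
have Dz : is_derive x 1 z (\row_j dz (inl j) x, \row_j dz (inr j) x).
  have -> : z = fun t => ((z t).1, (z t).2) by apply/funext => t; case: (z t).
  apply: is_derive_pair; apply: is_derive_row => j.
    by case: (hdz (inl j)) => _; apply.
  by case: (hdz (inr j)) => _; apply.
have := is_derive_coord i (is_derive_comp_curve (dF (z x)) Dz).
rewrite diff_decomp summxE; congr is_derive; apply: eq_bigr => -[] j _ /=;
  by rewrite !mxE.
Qed.

Lemma bounded_on_ball (W : normedModType R) (F : E -> W) (M : R) : continuous F ->
  exists C, forall X, `|X| <= M -> `|F X| <= C.
Proof.
move=> cF; pose B := [set u : 'rV[R]_m | `|u| <= M].
have cB : compact B.
  apply: bounded_closed_compact.
    exists M; split=> [|M' MM' u]; first exact: num_real.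
    by move=> /le_trans; apply; exact: ltW.
  apply: (@closed_comp _ _ _ [set x : R | x <= M]); last exact: closed_le.
  by move=> u _; exact: norm_continuous.
have cF' : {within B `*` B, continuous F} by exact: continuous_subspaceT.
have /compact_bounded[N [_ HN]] := continuous_compact cF' (compact_setX cB cB).
exists (`|N| + 1) => X; rewrite prod_normE ge_max => /andP[X1 X2].
apply: HN; first by apply: le_lt_trans (ler_norm N) _; rewrite ltrDl.
by exists X.
Qed.

Lemma coord_le_norm n (u : 'rV[R]_n) j : `|u 0 j| <= `|u|.
Proof.
rewrite [leRHS]/Num.norm /= mx_normrE.
exact: (le_bigmax _ (fun ij => `|u ij.1 ij.2|) (0, j)).
Qed.

Lemma norm_le_coord n (u : 'rV[R]_n) C : 0 <= C -> (forall j, `|u 0 j| <= C) ->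
  `|u| <= C.
Proof.
move=> C0 uC; rewrite /Num.norm /= mx_normrE; apply: bigmax_le => // -[i j] _ /=.
by rewrite ord1.
Qed.

(** The mean value theorem along a segment, one coordinate of the value at a
    time since the intermediate point depends on it. *)
Lemma mvt_pair n (F : E -> 'rV[R]_n) X Y i : (forall X, differentiable F X) ->
  exists2 t, 0 <= t <= 1 &
    F X 0 i - F Y 0 i =
    \sum_v pair_coord (X - Y) v * 'd F (Y + t *: (X - Y)) (pair_basis v) 0 i.
Proof.
move=> dF; pose z (t : R) := Y + t *: (X - Y).
have Dz (t : R) : is_derive t 1 z (X - Y).
  have lin : is_diff t (fun t : R => t *: (X - Y)) (fun t => t *: (X - Y)).
    exact: is_diff_scalel.
  have Dl : is_derive t 1 (fun t : R => t *: (X - Y)) (X - Y).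
    have [dl el] := lin; apply: DeriveDef; first exact/derivable1_diffP.
    by rewrite deriveE // el scale1r.
  by have := is_deriveD (is_derive_cst Y t 1) Dl; rewrite add0r.
pose phi t := F (z t) 0 i.
have dphi (t : R) : is_derive t 1 phi ('d F (z t) (X - Y) 0 i).
  exact: is_derive_coord (is_derive_comp_curve (dF _) (Dz t)).
have cphi : {within `[0, 1], continuous phi}.
  apply: continuous_subspaceT => t.
  by apply: differentiable_continuous; apply/derivable1_diffP; case: (dphi t).
have [t] := MVT_segment (ler01 : (0 : R) <= 1) (fun t _ => dphi t) cphi.
rewrite in_itv /= => t01 e; exists t => //.
move: e; rewrite /phi /z scale1r scale0r addr0 subr0 mulr1 [Y + _]addrC subrK.
move=> ->; rewrite diff_decomp summxE; apply: eq_bigr => v _.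
by rewrite mxE.
Qed.

Lemma segment_in_ball X Y (t M : R) : 0 <= t <= 1 -> `|X| <= M -> `|Y| <= M ->
  `|Y + t *: (X - Y)| <= M.
Proof.
move=> /andP[t0 t1] XM YM.
have -> : Y + t *: (X - Y) = (1 - t) *: Y + t *: X.
  by rewrite scalerBr scalerBl scale1r addrA addrAC.
apply: le_trans (ler_normD _ _) _; rewrite !normrZ !ger0_norm ?subr_ge0 //.
by have := ler_wpM2l t0 XM; have := @ler_wpM2l _ (1 - t) _ _ _ YM; lra.
Qed.

Lemma bounded_diff_on_ball n (F : E -> 'rV[R]_n) (M : R) : class_C 1 F ->
  exists2 L, 0 <= L & forall X v i, `|X| <= M -> `|'d F X (pair_basis v) 0 i| <= L.
Proof.
move=> [_ cdF].
have /choice[B HB] v : exists C, forall X, `|X| <= M -> `|'d F X (pair_basis v)| <= C.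
  by apply: bounded_on_ball; exact: cdF.
exists (\sum_v `|B v|) => [|X v i XM]; first exact: sumr_ge0.
apply: le_trans (coord_le_norm _ _) _; apply: le_trans (HB v _ XM) _.
by rewrite (bigD1 v) //=; apply: le_trans (ler_norm _) _; rewrite lerDl sumr_ge0.
Qed.

Lemma lipschitz_on_ball n (F : E -> 'rV[R]_n) (M : R) : class_C 1 F ->
  exists2 L, 0 <= L & forall X Y i, `|X| <= M -> `|Y| <= M ->
    `|F X 0 i - F Y 0 i| <= L * \sum_v `|pair_coord (X - Y) v|.
Proof.
move=> CF; have [L L0 HL] := bounded_diff_on_ball M CF; exists L => // X Y i XM YM.
have [t t01 ->] := mvt_pair X Y i (fun X => CF.1 X).
rewrite mulr_sumr; apply: le_trans (ler_norm_sum _ _ _) _.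
apply: ler_sum => v _; rewrite normrM mulrC ler_wpM2r //.
exact/HL/segment_in_ball.
Qed.

(** The mean value theorem evaluates the differential at an intermediate point;
    moving it to [X] costs a second factor, by the Lipschitz estimate for the
    differential. *)
Lemma linearization_on_ball n (F : E -> 'rV[R]_n) (M : R) : class_C 2 F ->
  exists2 L, 0 <= L & forall X Y i, `|X| <= M -> `|Y| <= M ->
    `|F X 0 i - F Y 0 i -
      \sum_v pair_coord (X - Y) v * 'd F X (pair_basis v) 0 i| <=
    L * (\sum_v `|pair_coord (X - Y) v|) ^+ 2.
Proof.
move=> [dF CdF].
have /choice[B HB] v : exists L, 0 <= L /\ forall X Y i, `|X| <= M -> `|Y| <= M ->
    `|'d F X (pair_basis v) 0 i - 'd F Y (pair_basis v) 0 i| <=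
    L * \sum_v `|pair_coord (X - Y) v|.
  by have [L L0 HL] := lipschitz_on_ball M (CdF (pair_basis v)); exists L.
exists (\sum_v B v) => [|X Y i XM YM]; first by apply: sumr_ge0 => v _; case: (HB v).
have [t t01 ->] := mvt_pair X Y i dF; rewrite -sumrB.
set Z := Y + _; set S := \sum_v `|pair_coord (X - Y) v|.
have S0 : 0 <= S by exact: sumr_ge0.
have ZX : \sum_v `|pair_coord (Z - X) v| <= S.
  apply: ler_sum => v _; have -> : Z - X = (t - 1) *: (X - Y).
    by rewrite /Z scalerBl scale1r opprB -addrA addrCA.
  have -> : pair_coord ((t - 1) *: (X - Y)) v = (t - 1) * pair_coord (X - Y) v.
    by case: v => j /=; rewrite mxE.
  by rewrite normrM ler_piMl // ler0_norm; lra.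
rewrite expr2 mulrA mulr_sumr; apply: le_trans (ler_norm_sum _ _ _) _.
apply: ler_sum => v _; rewrite -mulrBr normrM mulrC ler_wpM2r //.
have [B0 /(_ Z X i) hB] := HB v.
apply: le_trans (hB _ XM) _; first exact: segment_in_ball.
apply: ler_pM => //; first exact: sumr_ge0.
rewrite (bigD1 v) //= lerDl; apply: sumr_ge0 => v' _; by case: (HB v').
Qed.

End Pairs.

(** * One step along a smooth piece of the solution *)

Section ScalePoly.
Context {R : realType}.
Implicit Types p : {poly R}.

(** [p] composed with the change of variable from the reference interval
    [[0, 1]] to a step of length [a]. *)
Definition scale_poly (a : R) p : {poly R} := \poly_(l < size p) (p`_l * a ^+ l).

Lemma size_scale_poly a p : (size (scale_poly a p) <= size p)%N.
Proof. exact: size_poly. Qed.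

Lemma coef_scale_poly a p l : (scale_poly a p)`_l = p`_l * a ^+ l.
Proof. by rewrite coef_poly; case: ltnP => // /(nth_default 0) ->; rewrite mul0r. Qed.

Lemma horner_scale_poly a p x : (scale_poly a p).[x] = p.[x * a].
Proof.
rewrite (horner_coef_wide _ (size_scale_poly a p)) horner_coef.
by apply: eq_bigr => l _; rewrite coef_scale_poly exprMn mulrA mulrAC.
Qed.

Lemma primitive_scale_poly a p x :
  a * (primitive (scale_poly a p)).[x] = (primitive p).[x * a].
Proof.
have sz : (size (primitive (scale_poly a p)) <= (size p).+1)%N.
  by apply: leq_trans (size_primitive _) _; rewrite ltnS size_scale_poly.
rewrite (horner_coef_wide _ sz) (horner_coef_wide _ (size_primitive p)) mulr_sumr.
apply: eq_bigr => -[[|l] lt_l] _ /=; rewrite !coef_primitive.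
  by rewrite invr0 !mulr0 !mul0r mulr0.
by rewrite coef_scale_poly /= exprMn [a ^+ l.+1]exprS; ring.
Qed.

End ScalePoly.

Section OneStep.
Context {R : realType} {k m : nat}.
Variables (b c : 'I_k -> R) (s : nat) (P : nat -> {poly R}).
Hypothesis exact_quad : quadrature_order b c (2 * s).
Hypothesis basisP : legendre_basis P.
Hypothesis s_gt0 : (0 < s)%N.
Hypothesis c01 : forall l, 0 <= c l <= 1.
Variables (f : 'rV[R]_m * 'rV[R]_m -> 'rV[R]_m) (y w : R -> 'rV[R]_m) (ta tb : R).
Hypothesis Cf : class_C (2 * s) f.
Hypothesis cont_y : {within `[ta, tb], continuous y}.
Hypothesis cont_w : {within `[ta, tb], continuous w}.
Hypothesis smooth_w : forall j, smooth_on (2 * s) ta tb (fun t => w t 0 j).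
Hypothesis ode_y : forall t, ta < t < tb -> is_derive t 1 y (f (y t, w t)).

Local Notation quad := (quad b c).
Local Notation proj := (proj b c s P).
Local Notation proj_defect := (proj_defect b c s P).
Local Notation E := ('rV[R]_m * 'rV[R]_m)%type.

Let z t : E := (y t, w t).

Let cont_z : {within `[ta, tb], continuous z}.
Proof.
move=> x; exact: (@cvg_pair _ _ _ (nbhs x) (nbhs (y x)) (nbhs (w x))
  _ _ _ y w (@cont_y x) (@cont_w x)).
Qed.

(** Bootstrapping along the equation gains one derivative over the delayed
    argument. *)
Lemma smooth_solution j : smooth_on (2 * s).+1 ta tb (fun t => y t 0 j).
Proof.
suff sm n : (n <= (2 * s).+1)%N -> forall j, smooth_on n ta tb (fun t => y t 0 j).
  exact: sm.
elim: n => [|n IHn] ns i.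
  by split=> //; exact: within_continuous_coord.
split; first exact: smooth_on_continuous (IHn (ltnW ns) i).
exists (fun t => f (z t) 0 i); last first.
  by move=> x xab; apply: is_derive_coord; exact: ode_y.
apply: smooth_on_comp => //; first exact: class_C_le Cf.
move=> [v|v]; first exact: IHn (ltnW ns) v.
exact: smooth_on_le (smooth_w v).
Qed.

Let smooth_z n v : (n <= 2 * s)%N ->
  smooth_on n ta tb (fun t => pair_coord (z t) v).
Proof.
move=> ns; case: v => v; last exact: smooth_on_le (smooth_w v).
by apply: smooth_on_le (smooth_solution v); exact: leqW.
Qed.

Let smooth_field j : smooth_on (2 * s) ta tb (fun t => f (z t) 0 j).
Proof. by apply: smooth_on_comp => // v; exact: smooth_z. Qed.

Let smooth_jacobian j v :
  smooth_on s ta tb (fun t => 'd f (z t) (pair_basis v) 0 j).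
Proof.
apply: (smooth_on_comp (F := fun X => 'd f X (pair_basis v))) => //; last first.
  by move=> v'; apply: smooth_z; lia.
have : class_C (2 * s).-1.+1 f by rewrite prednK //; lia.
by move=> [_ /(_ (pair_basis v))]; apply: class_C_le; lia.
Qed.

(** [u] is the numerical solution on one step, rescaled to [[0, 1]], that starts
    from [y0] at time [t] and uses [v] as delayed argument. *)
Record one_step (M Cd h t : R) (u v : R -> 'rV[R]_m) (y0 : 'rV[R]_m) : Prop := {
  step_h : 0 < h <= 1;
  step_start : ta <= t;
  step_end : t + h <= tb;
  step_eq : forall x, 0 <= x <= 1 -> forall j,
    u x 0 j = y0 0 j + h * (primitive (proj (fun x => f (u x, v x) 0 j))).[x];
  step_y0 : `|y t - y0| <= 1;
  step_bound : forall l, `|(u (c l), v (c l))| <= M;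
  step_delay : forall l, `|w (t + c l * h) - v (c l)| <= Cd * h ^+ (s + 1);
  step_delay_moment : forall n j, (n + 2 <= s)%N ->
    `|h ^+ n * quad (fun x => (1 - x) ^+ n * (w (t + x * h) - v x) 0 j)| <=
      Cd * h ^+ (2 * s) }.

Section Family.
Variables (M Cd G L L2 : R).
Hypothesis z_bound : forall t, ta <= t <= tb -> `|z t| <= M.
Hypothesis G_ge0 : 0 <= G.
Hypothesis G_bound : forall g t, 0 <= t <= 1 ->
    `|(primitive (proj g)).[t]| <= G * \sum_(l < k) `|g (c l)|.
Hypothesis L_ge0 : 0 <= L.
Hypothesis f_lipschitz : forall X Y i, `|X| <= M -> `|Y| <= M ->
    `|f X 0 i - f Y 0 i| <= L * \sum_v `|pair_coord (X - Y) v|.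
Hypothesis f_linear : forall X Y i, `|X| <= M -> `|Y| <= M ->
    `|f X 0 i - f Y 0 i -
      \sum_v pair_coord (X - Y) v * 'd f X (pair_basis v) 0 i| <=
    L2 * (\sum_v `|pair_coord (X - Y) v|) ^+ 2.

(** The index set of the families of estimates.  The point [ix] of the step
    belongs to it, which makes the pointwise bounds uniform over the step. *)
Record instance := Instance {
  ih : R; it : R; iu : R -> 'rV[R]_m; iv : R -> 'rV[R]_m; iy : 'rV[R]_m; ix : R;
  instanceP : one_step M Cd ih it iu iv iy;
  instance_small : ih * (2 * (k%:R * #|'I_m|%:R * G * L)) <= 1;
  instance_x : 0 <= ix <= 1 }.

Implicit Types i : instance.

Let x i := `|y (it i) - iy i|.
Let zi i t : E := z (it i + t * ih i).
Let ui i t : E := (iu i t, iv i t).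
Let eta i v (t : R) := pair_coord (zi i t - ui i t) v.
Let e0 i j := (y (it i) - iy i) 0 j.
Let phi i j t := f (zi i t) 0 j.
Let D i j t := y (it i + t * ih i) 0 j - y (it i) 0 j -
  ih i * (primitive (proj (phi i j))).[t].
Let g i j t := f (zi i t) 0 j - f (ui i t) 0 j.

Let h01 i : 0 < ih i <= 1. Proof. by case: (instanceP i). Qed.
Let h0 i : 0 <= ih i. Proof. by case/andP: (h01 i) => /ltW. Qed.

Let it_ab i : ta <= it i <= tb.
Proof. by have [/andP[? ?] ? ? _ _ _ _ _] := instanceP i; lra. Qed.

Let itx_ab i (t : R) : 0 <= t <= 1 -> ta <= it i + t * ih i <= tb.
Proof.
move=> /andP[t0 t1]; have [/andP[h_0 _] ? ? _ _ _ _ _] := instanceP i.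
by have := ler_piMl (ltW h_0) t1; have := mulr_ge0 t0 (ltW h_0); lra.
Qed.

Let error_eq i j (t : R) : 0 <= t <= 1 ->
  eta i (inl j) t = e0 i j + D i j t + ih i * (primitive (proj (g i j))).[t].
Proof.
move=> t01; have := step_eq (instanceP i) t01 j.
rewrite /eta /= !mxE => ->.
rewrite /g projB linearB hornerD hornerN /e0 /D /phi !mxE; ring.
Qed.

(** The defect is split along the Taylor polynomial [Q] of the derivative of the
    solution at the beginning of the step; the remainder collects the two Taylor
    remainders, of the solution and of its derivative. *)
Let D_defect j : exists Q r,
  [/\ forall i, (size (Q i : {poly R}) <= 2 * s)%N,
      forall n, isO (fun i => (Q i)`_n) (fun i => ih i ^+ n),
      forall i (t : R), 0 <= t <= 1 ->
        D i j t = ih i * (proj_defect (Q i)).[t] + r i t &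
      forall t : instance -> R, (forall i, 0 <= t i <= 1) ->
        isO (fun i => r i (t i)) (fun i => ih i ^+ (2 * s + 1))].
Proof.
have [C [tp T]] := smooth_on_taylor (smooth_field j).
pose Q i := scale_poly (ih i) (tp (it i)).
pose r i t := y (it i + t * ih i) 0 j - y (it i) 0 j - (primitive (tp (it i))).[t * ih i]
  - ih i * (primitive (proj (fun x => phi i j x - (Q i).[x]))).[t].
have near_t i (t : R) : 0 <= t <= 1 -> `|t * ih i| <= ih i.
  move=> /andP[t0 t1]; rewrite ger0_norm ?mulr_ge0 //.
  by rewrite ler_piMl.
have C0 i : 0 <= C.
  by have [_ /(_ 0%N) cf _] := T _ (it_ab i); exact: le_trans cf.
exists Q, r; split=> [i|n|i t t01|t t01].
- by apply: leq_trans (size_scale_poly _ _) _; case: (T _ (it_ab i)).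
- exists C => i; rewrite coef_scale_poly normrM normrX (ger0_norm (h0 i)).
  by rewrite ler_wpM2r ?exprn_ge0 //; case: (T _ (it_ab i)).
- rewrite /D /r projB hornerD hornerN linearB hornerD hornerN.
  by rewrite -primitive_scale_poly -/(Q i); ring.
- apply: isOB.
    exists C => i.
    have dy (u : R) : ta < u < tb -> is_derive u 1 (fun t => y t 0 j) (f (z u) 0 j).
      by move=> xab; apply: is_derive_coord; exact: ode_y.
    have := taylor_primitive T (smooth_on_continuous (smooth_solution j)) dy
      (it_ab i) (itx_ab i (t01 i)).
    rewrite (addrAC (it i)) subrr add0r; move/le_trans; apply.
    rewrite addn1 ler_wpM2l ?(C0 i) // lerXn2r ?nnegrE //.
    exact: near_t.
  exists (G * (k%:R * C)) => i.
  rewrite normrM (ger0_norm (h0 i)) addn1 exprS mulrCA ler_wpM2l //.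
  apply: le_trans (G_bound _ (t01 i)) _; rewrite -mulrA ler_wpM2l //.
  apply: (@le_trans _ _ (\sum_(l < k) C * ih i ^+ (2 * s))); last first.
    by rewrite sumr_const card_ord -[leLHS]mulr_natl mulrA.
  apply: ler_sum => l _; rewrite /phi /Q horner_scale_poly.
  have [_ _ /(_ _ (itx_ab i (c01 l)))] := T _ (it_ab i).
  rewrite (addrAC (it i)) subrr add0r => /le_trans; apply.
  rewrite ler_wpM2l ?(C0 i) // lerXn2r ?nnegrE //.
  exact: near_t.
Qed.

Let A i j v t := 'd f (zi i t) (pair_basis v) 0 j.

(** Expansion at the end of the step, hence in powers of [- ih i * (1 - t)]. *)
Let A_taylor : exists al : instance -> 'I_m -> 'I_m + 'I_m -> nat -> R,
  (forall j v n, isO (fun i => al i j v n) (fun i => ih i ^+ n)) /\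
  (forall j v l,
    isO (fun i => A i j v (c l) - \sum_(n < s) al i j v n * (1 - c l) ^+ n)
        (fun i => ih i ^+ s)).
Proof.
have /choice[Ctp T] (jv : 'I_m * ('I_m + 'I_m)) : exists Ctp : R * (R -> {poly R}),
    taylor s ta tb (fun t => 'd f (z t) (pair_basis jv.2) 0 jv.1) Ctp.1 Ctp.2.
  by have [C [tp T]] := smooth_on_taylor (smooth_jacobian jv.1 jv.2); exists (C, tp).
have end_ab i : ta <= it i + ih i <= tb.
  by have := itx_ab i (_ : 0 <= 1 <= 1); rewrite mul1r; apply; rewrite ler01 lexx.
exists (fun i j v n => ((Ctp (j, v)).2 (it i + ih i))`_n * (- ih i) ^+ n).
split=> [j v n|j v l].
  exists (Ctp (j, v)).1 => i; rewrite normrM normrX normrN (ger0_norm (h0 i)).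
  by rewrite ler_wpM2r ?exprn_ge0 //; case: (T (j, v) _ (end_ab i)).
exists (Ctp (j, v)).1 => i.
have [sz cf /(_ _ (itx_ab i (c01 l))) /= E] := T (j, v) _ (end_ab i).
have C0 : 0 <= (Ctp (j, v)).1 by exact: le_trans (normr_ge0 _) (cf 0%N).
have uE : it i + c l * ih i - (it i + ih i) = - ih i * (1 - c l) by ring.
move: E; rewrite uE (horner_coef_wide _ sz).
under eq_bigr do rewrite -mulrA -exprMn.
move/le_trans; apply; rewrite ler_wpM2l // lerXn2r ?nnegrE //.
have /andP[c0 c1] := c01 l.
by rewrite mulNr normrN ger0_norm ?mulr_ge0 ?subr_ge0 // ler_piMr // gerBl.
Qed.

Let zi_bound i l : `|zi i (c l)| <= M.
Proof. by apply: z_bound; exact: itx_ab. Qed.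

Let ui_bound i l : `|ui i (c l)| <= M.
Proof. exact: step_bound (instanceP i) l. Qed.

Let g_lipschitz i j l : `|g i j (c l)| <= L * \sum_v `|eta i v (c l)|.
Proof. exact: f_lipschitz. Qed.

Let g_linear j l :
  isO (fun i => g i j (c l) - \sum_v A i j v (c l) * eta i v (c l))
      (fun i => (\sum_v `|eta i v (c l)|) ^+ 2).
Proof.
exists L2 => i; under eq_bigr do rewrite mulrC.
exact: f_linear.
Qed.

Let x01 i : 0 <= x i <= 1.
Proof. by rewrite normr_ge0; case: (instanceP i). Qed.

Let e0_le i j : `|e0 i j| <= x i.
Proof. exact: coord_le_norm. Qed.

Let D_bounds j :
  [/\ forall t : instance -> R, (forall i, 0 <= t i <= 1) ->
        isO (fun i => D i j (t i)) (fun i => ih i ^+ (s + 1)),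
      forall n, (n + 2 <= s)%N ->
        isO (fun i => ih i ^+ n * quad (fun t => (1 - t) ^+ n * D i j t))
            (fun i => ih i ^+ (2 * s)) &
      isO (fun i => D i j 1) (fun i => ih i ^+ (2 * s + 1))].
Proof.
have [Q [r [szQ cQ DE rO]]] := D_defect j; split.
- exact: (defect_point exact_quad basisP s_gt0 h01 szQ cQ DE rO).
- by move=> n ns; exact: (defect_moment exact_quad basisP s_gt0 c01 h01 szQ cQ DE rO).
- exact: (defect_end exact_quad basisP s_gt0 szQ DE rO).
Qed.

Let delay_node j l :
  isO (fun i => eta i (inr j) (c l)) (fun i => ih i ^+ (s + 1)).
Proof.
exists Cd => i; apply: le_trans (step_delay (instanceP i) l).
exact: coord_le_norm.
Qed.

Let delay_moment j n : (n + 2 <= s)%N ->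
  isO (fun i => ih i ^+ n * quad (fun t => (1 - t) ^+ n * eta i (inr j) t))
      (fun i => ih i ^+ (2 * s)).
Proof. by move=> ns; exists Cd => i; exact: step_delay_moment (instanceP i) _ j ns. Qed.

Lemma one_step_family :
  [/\ forall j, isO (fun i => (y (it i + ix i * ih i) - iu i (ix i)) 0 j)
                    (fun i => x i + ih i ^+ (s + 1)),
      forall n j, isO (fun i => ih i ^+ n * quad (fun t =>
                        (1 - t) ^+ n * (y (it i + t * ih i) - iu i t) 0 j))
                    (fun i => x i + ih i ^+ (2 * s)) &
      forall j, isO (fun i => (y (it i + ih i) - iu i 1 - (y (it i) - iy i)) 0 j)
                    (fun i => ih i * (x i + ih i ^+ (2 * s)))].
Proof.
have [al [al_small A_tay]] := A_taylor.
have D_point j := let: And3 p _ _ := D_bounds j in p.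
have D_moment j := let: And3 _ p _ := D_bounds j in p.
have D_end j := let: And3 _ _ p := D_bounds j in p.
have eta_node := error_node c01 h01 x01 e0_le error_eq D_point delay_node
  g_lipschitz G_ge0 G_bound instance_small.
split=> [j|n j|j].
- exact: (error_point h01 x01 e0_le error_eq D_point g_lipschitz L_ge0 eta_node
    j instance_x).
- exact: (moment_small exact_quad basisP s_gt0 c01 h01 x01 e0_le error_eq D_moment
    delay_moment L_ge0 g_linear al_small A_tay eta_node n (inl j)).
- have := error_end exact_quad basisP s_gt0 c01 h01 x01 e0_le error_eq D_moment D_end
    delay_moment L_ge0 g_linear al_small A_tay eta_node j.
  by apply: isO_ext => i; rewrite /eta /e0 /= !mxE !mul1r.
Qed.

End Family.

Lemma one_step_error M Cd : (forall t, ta <= t <= tb -> `|z t| <= M) ->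
  exists C Lam, [/\ 0 <= C, 0 <= Lam & forall h t u v y0,
    one_step M Cd h t u v y0 -> h * Lam <= 1 ->
    [/\ forall x, 0 <= x <= 1 ->
          `|y (t + x * h) - u x| <= C * (`|y t - y0| + h ^+ (s + 1)),
        forall n j, (n + 2 <= s)%N -> `|h ^+ n * quad (fun x =>
           (1 - x) ^+ n * (y (t + x * h) - u x) 0 j)| <=
           C * (`|y t - y0| + h ^+ (2 * s)) &
        `|y (t + h) - u 1 - (y t - y0)| <= C * (h * (`|y t - y0| + h ^+ (2 * s)))]].
Proof.
move=> zM.
have [G G0 hG] := primitive_proj_bound b c s P.
have [L L0 hL] : exists2 L, 0 <= L & forall X Y i, `|X| <= M -> `|Y| <= M ->
    `|f X 0 i - f Y 0 i| <= L * \sum_v `|pair_coord (X - Y) v|.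
  by apply: lipschitz_on_ball; apply: class_C_le Cf; lia.
have [L2 _ hL2] : exists2 L, 0 <= L & forall X Y i, `|X| <= M -> `|Y| <= M ->
    `|f X 0 i - f Y 0 i -
      \sum_v pair_coord (X - Y) v * 'd f X (pair_basis v) 0 i| <=
    L * (\sum_v `|pair_coord (X - Y) v|) ^+ 2.
  by apply: linearization_on_ball; apply: class_C_le Cf; lia.
have [Hp Hm He] := one_step_family Cd zM G0 hG L0 hL hL2.
pose inst := instance M Cd G L.
have h_ge0 (i : inst) : 0 <= ih i.
  by have [/andP[/ltW]] := instanceP i.
have [C1 C10 hC1] := isO_unif (fun i : inst =>
  addr_ge0 (normr_ge0 _) (exprn_ge0 _ (h_ge0 i))) Hp.
have [C2 C20 hC2] := isO_unif (fun i : inst =>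
  addr_ge0 (normr_ge0 _) (exprn_ge0 _ (h_ge0 i)))
  (fun nj : 'I_s * 'I_m => Hm nj.1 nj.2).
have [C3 C30 hC3] := isO_unif (fun i : inst => mulr_ge0 (h_ge0 i)
  (addr_ge0 (normr_ge0 _) (exprn_ge0 _ (h_ge0 i)))) He.
exists (C1 + C2 + C3), (2 * (k%:R * #|'I_m|%:R * G * L)); split.
- by rewrite !addr_ge0.
- by rewrite !mulr_ge0.
move=> h t u v y0 ok small; have [/andP[/ltW h0 _] _ _ _ _ _ _ _] := ok.
have a0 n : 0 <= `|y t - y0| + h ^+ n by rewrite addr_ge0 ?exprn_ge0.
have i01 : 0 <= (1 : R) <= 1 by rewrite ler01 lexx.
have CC0 : 0 <= C1 + C2 + C3 by rewrite !addr_ge0.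
split=> [x x01|n j ns|].
- apply: norm_le_coord => [|j]; first exact: mulr_ge0 CC0 (a0 _).
  apply: le_trans (hC1 j (Instance ok small x01)) _ => /=.
  by rewrite ler_wpM2r // -addrA lerDl addr_ge0.
- have ns' : (n < s)%N by lia.
  apply: le_trans (hC2 (Ordinal ns', j) (Instance ok small i01)) _ => /=.
  by rewrite ler_wpM2r // addrAC lerDr addr_ge0.
- apply: norm_le_coord => [|j]; first exact: mulr_ge0 CC0 (mulr_ge0 h0 (a0 _)).
  apply: le_trans (hC3 j (Instance ok small i01)) _ => /=.
  by rewrite ler_wpM2r ?mulr_ge0 // lerDr addr_ge0.
Qed.

End OneStep.

(** * Propagation of the error through the delay intervals *)

Lemma vector_norm_le (R : realType) m (N : 'rV[R]_m -> R) : vector_norm N ->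
  exists2 C, 0 <= C & forall v, N v <= C * `|v|.
Proof.
case=> N0 _ NZ ND; exists (\sum_j N (delta_mx 0 j)) => [|v]; first exact: sumr_ge0.
have N00 : N 0 = 0 by rewrite -(scale0r 0) NZ normr0 mul0r.
rewrite {1}[v]row_sum_delta mulr_suml.
apply: (@le_trans _ _ (\sum_j N (v 0 j *: delta_mx 0 j))).
  elim/big_ind2: _ => [|x1 x2 y1 y2 h1 h2|//]; first by rewrite N00.
  by rewrite (le_trans (ND _ _)) // lerD.
apply: ler_sum => j _; rewrite NZ mulrC ler_wpM2l //; exact: coord_le_norm.
Qed.

(** Discrete Gronwall lemma; the recursive bound is only available as long as
    the error has not left the unit ball. *)
Lemma gronwall (R : realType) (e : nat -> R) (nu : nat) (h C C0 q tau : R) :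
  0 <= h -> 0 <= C -> 0 <= C0 -> 0 <= q -> tau = nu%:R * h ->
  (forall p, 0 <= e p) -> e 0%N <= C0 * q ->
  expR (C * tau) * (C0 + 1) * q <= 1 ->
  (forall p, (p < nu)%N -> e p <= 1 -> e p.+1 <= e p + C * (h * (e p + q))) ->
  forall p, (p <= nu)%N -> e p + q <= expR (C * tau) * (C0 + 1) * q.
Proof.
move=> h0 C_0 C00 q0 tauE e0 e0q Bq step.
have le_exp p : (p <= nu)%N ->
    expR (C * h) ^+ p * (C0 + 1) * q <= expR (C * tau) * (C0 + 1) * q.
  move=> pnu; rewrite ler_wpM2r // ler_wpM2r ?addr_ge0 // -expRM_natl ler_expR tauE.
  by rewrite [leLHS]mulrCA ler_wpM2l // ler_wpM2r // ler_nat.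
suff H p : (p <= nu)%N -> e p + q <= expR (C * h) ^+ p * (C0 + 1) * q.
  by move=> p pnu; apply: le_trans (H p pnu) (le_exp p pnu).
elim: p => [|p IHp] pnu.
  by rewrite expr0 mul1r mulrDl mul1r lerD2r.
have {}IHp := IHp (ltnW pnu).
have : e p <= 1.
  apply: le_trans Bq; apply: (@le_trans _ _ (e p + q)); first by rewrite lerDl.
  exact: le_trans IHp (le_exp _ (ltnW pnu)).
move=> /(step _ pnu) ep.
apply: (@le_trans _ _ ((1 + C * h) * (e p + q))).
  by move: ep; rewrite mulrDl mul1r mulrA addrAC; lra.
rewrite exprS -!mulrA; apply: ler_pM => //.
- by rewrite addr_ge0 // mulr_ge0.
- by rewrite addr_ge0.
- exact: expR_ge1Dx.
- by rewrite mulrA.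
Qed.

Lemma step_decomp (i nu : nat) (n : int) : (i * nu)%N%:Z < n ->
  n <= (i.+1 * nu)%N%:Z -> exists2 p, (p < nu)%N & n = (i * nu + p).+1%:Z.
Proof.
case: n => // n; rewrite ltz_nat lez_nat mulSn => n_gt nS.
by exists (n - (i * nu).+1)%N; [lia | congr Posz; lia].
Qed.

Lemma delayed_index (i nu p : nat) :
  (i.+1 * nu + p).+1%:Z - nu%:Z = (i * nu + p).+1%:Z.
Proof. by rewrite mulSn; lia. Qed.

Section Delay.
Context {R : realType} {k m : nat}.
Variables (b c : 'I_k -> R) (s : nat) (P : nat -> {poly R}).
Hypothesis exact_quad : quadrature_order b c (2 * s).
Hypothesis basisP : legendre_basis P.
Hypothesis s_gt0 : (0 < s)%N.
Hypothesis c01 : forall l, 0 <= c l <= 1.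
Variables (f : 'rV[R]_m * 'rV[R]_m -> 'rV[R]_m) (phi y : R -> 'rV[R]_m).
Variables (y0 : 'rV[R]_m) (t0 T tau : R) (K : nat) (D : nat -> R -> 'rV[R]_m).
Hypothesis tau_gt0 : 0 < tau.
Hypothesis T_def : T - t0 = K%:R * tau.
Hypothesis Cf : class_C (2 * s) f.
Hypothesis D_phi : forall t, t0 - tau <= t <= t0 -> D 0%N t = phi t.
Hypothesis D_cont : forall i, (i <= 2 * s)%N ->
  {within `[t0 - tau, t0], continuous (D i)}.
Hypothesis D_derive : forall i t, (i < 2 * s)%N -> t0 - tau < t < t0 ->
  is_derive t 1 (D i) (D i.+1 t).
Hypothesis y_sol : dde_solution f phi y0 t0 T tau y.

Local Notation quad := (quad b c).
Local Notation proj := (proj b c s P).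
Local Notation approximation rho nu h u yn :=
  (pw_approximation s f P b c phi y0 t0 h rho nu (K * nu)%N u yn).

Definition piece_start (p : nat) : R := t0 + p%:R * tau.

Lemma piece_startS p : piece_start p.+1 = piece_start p + tau.
Proof. by rewrite /piece_start mulrS mulrDl mul1r addrA addrAC. Qed.

(** Delayed argument on the delay interval of index [p], where it is smooth up to
    the end points; at [t0] the solution itself may differ from [phi]. *)
Definition delayed (p : nat) (t : R) : 'rV[R]_m :=
  (if p is 0%N then D 0%N else y) (t - tau).

Lemma smooth_history n i j : (i + n <= 2 * s)%N ->
  smooth_on n (t0 - tau) t0 (fun t => D i t 0 j).
Proof.
elim: n i => [|n IHn] i ins.
  by split=> //; apply: within_continuous_coord; apply: D_cont; lia.
split; first by apply: within_continuous_coord; apply: D_cont; lia.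
exists (fun t => D i.+1 t 0 j); first by apply: IHn; lia.
by move=> t tab; apply: is_derive_coord; apply: D_derive => //; lia.
Qed.

Lemma piece_in p : (p < K)%N -> t0 <= piece_start p /\ piece_start p.+1 <= T.
Proof.
move=> pK; have -> : T = t0 + K%:R * tau by rewrite -T_def addrC subrK.
rewrite /piece_start; split; first by rewrite lerDl mulr_ge0 // ltW.
by rewrite lerD2l ler_wpM2r ?(ltW tau_gt0) // ler_nat.
Qed.

Lemma piece_continuous p : (p < K)%N ->
  {within `[piece_start p, piece_start p.+1], continuous y}.
Proof.
move=> /piece_in[h1 h2]; apply: continuous_subspaceW (dde_cont y_sol) => t /=.
by rewrite !in_itv /=; lra.
Qed.

Lemma piece_ode p : (p < K)%N -> forall t, piece_start p < t < piece_start p.+1 ->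
  is_derive t 1 y (f (y t, delayed p t)).
Proof.
move=> pK t; rewrite piece_startS => tp.
have [h1 h2] := piece_in pK; rewrite piece_startS in h2.
have -> : delayed p t = y (t - tau).
  case: p {pK h1 h2} tp => [|p] //; rewrite /piece_start mul0r addr0 => tp.
  by rewrite /delayed (dde_history y_sol) ?D_phi //; lra.
apply: (dde_eq y_sol); first lra.
case: p {pK h1 h2} tp => [|p].
  by rewrite /piece_start mul0r addr0 => tp; rewrite lt_eqF //; lra.
rewrite piece_startS => /andP[tp _]; rewrite gt_eqF //; apply: le_lt_trans tp.
by rewrite lerD2r /piece_start lerDl mulr_ge0 // ltW.
Qed.

(** The solution on one delay interval, shifted by [tau], is the delayed argument
    on the next one; the discontinuities of its derivatives stay at the end points
    of these intervals, which are grid points. *)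
Lemma delayed_smooth p : (p < K)%N ->
  {within `[piece_start p, piece_start p.+1], continuous (delayed p)} /\
  forall j, smooth_on (2 * s) (piece_start p) (piece_start p.+1)
    (fun t => delayed p t 0 j).
Proof.
elim: p => [|p IHp] pK.
  have e0 : piece_start 0 = t0 - tau + tau by rewrite /piece_start mul0r addr0 subrK.
  have -> : piece_start 1 = t0 + tau by rewrite piece_startS e0 subrK.
  rewrite e0; split=> [|j]; first by apply: within_continuous_shift; exact: D_cont.
  exact: smooth_on_shift (@smooth_history (2 * s) 0 j (leqnn _)).
have [cw sw] := IHp (ltnW pK); have cy := piece_continuous (ltnW pK).
split=> [|j].
  by have := within_continuous_shift (d := tau) cy; rewrite -!piece_startS.
have sy := smooth_solution Cf cy cw sw (piece_ode (ltnW pK)) j.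
by have := smooth_on_shift tau (smooth_onS sy); rewrite -!piece_startS.
Qed.

Lemma within_bounded (g : R -> 'rV[R]_m) ta tb :
  {within `[ta, tb], continuous g} -> exists2 M, 0 <= M &
  forall t, ta <= t <= tb -> `|g t| <= M.
Proof.
move=> cg; have [M [_ HM]] :=
  compact_bounded (continuous_compact cg (@segment_compact _ ta tb)).
exists (`|M| + 1) => [|t tab]; first exact: addr_ge0.
apply: HM; first by apply: le_lt_trans (ler_norm M) _; rewrite ltrDl.
by exists t => //; rewrite /= in_itv.
Qed.

Lemma approximation_eq rho nu h u yn (n : int) : approximation rho nu h u yn ->
  1 <= n <= (K * nu)%N%:Z -> forall x, 0 <= x <= 1 -> forall j,
  u n (x * h) 0 j = yn (n - 1) 0 j + h * (primitive (proj (fun x =>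
    f (u n (x * h), u (n - nu%:Z) (x * h)) 0 j))).[x].
Proof.
move=> A nK x x01 j; rewrite (apx_step A nK x01) !mxE; congr (_ + h * _).
rewrite linear_sum horner_sum summxE; apply: eq_bigr => p _.
rewrite linearZ hornerZ mxE Rintegral_poly; last by case/andP: x01.
rewrite mulrC; congr (_ * _); rewrite /gamma_hat summxE; apply: eq_bigr => l _.
by rewrite mxE mulrA.
Qed.

(** All that the steps of the delay interval of index [i] have to know about the
    preceding one.  The moments are kept besides the size because the grid values
    could not be superconvergent without them. *)
Definition delay_error (C : R) (i nu : nat) (h : R) (u : int -> R -> 'rV[R]_m) :=
  forall p : nat, (p < nu)%N ->
  let e x := delayed i (piece_start i + p%:R * h + x * h) -
    u ((i * nu + p).+1%:Z - nu%:Z) (x * h) in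
  (forall l, `|e (c l)| <= C * h ^+ (s + 1)) /\
  (forall n j, (n + 2 <= s)%N ->
    `|h ^+ n * quad (fun x => (1 - x) ^+ n * e x 0 j)| <= C * h ^+ (2 * s)).

(** The constant is chosen before [rho].  It comes from a ball of radius [M0 + 2]
    around the solution; the ball that depends on [rho] only serves to prove that
    the numerical solution does not leave the former when [h] is small. *)
Lemma piece_step i Cd : (i < K)%N -> 0 <= Cd ->
  exists2 C, 0 <= C & forall rho, 0 < rho -> exists2 h0, 0 < h0 &
  forall nu h u yn, 0 < h <= h0 -> tau = nu%:R * h ->
  approximation rho nu h u yn -> delay_error Cd i nu h u ->
  forall p, (p < nu)%N ->
  let t := piece_start i + p%:R * h in
  let n := (i * nu + p).+1%:Z in
  let x := `|y t - yn (i * nu + p)%N| in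
  x <= 1 ->
  [/\ forall a, 0 <= a <= 1 ->
        `|y (t + a * h) - u n (a * h)| <= C * (x + h ^+ (s + 1)),
      forall n' j, (n' + 2 <= s)%N ->
        `|h ^+ n' * quad (fun a => (1 - a) ^+ n' *
            (y (t + a * h) - u n (a * h)) 0 j)| <= C * (x + h ^+ (2 * s)) &
      `|y (t + h) - yn n - (y t - yn (i * nu + p)%N)| <=
        C * (h * (x + h ^+ (2 * s)))].
Proof.
move=> iK Cd0; have [cw sw] := delayed_smooth iK.
have cy := piece_continuous iK.
have [My My0 yM] := within_bounded cy; have [Mw Mw0 wM] := within_bounded cw.
pose M0 := My + Mw.
have zM t : piece_start i <= t <= piece_start i.+1 ->
    `|(y t, delayed i t)| <= M0 + 2.
  move=> tab; rewrite prod_normE ge_max /=; have := yM _ tab; have := wM _ tab.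
  by rewrite /M0; lra.
have [C [Lam [C0 Lam0 step]]] := one_step_error exact_quad basisP s_gt0 c01 Cf cy cw
  sw (piece_ode iK) Cd zM.
have [G G0 hG] := primitive_proj_bound b c s P.
exists C => // rho rho0.
have [B hB] := bounded_on_ball (M0 + 1 + rho) (class_C_continuous Cf).
(* All the smallness conditions on h have the form h * X <= 1. *)
pose S := 1 + Lam + Cd + G * (k%:R * `|B|).
have GB0 : 0 <= G * (k%:R * `|B|) by rewrite !mulr_ge0.
have S0 : 0 < S by rewrite /S; lra.
exists S^-1; first by rewrite invr_gt0.
move=> nu h u yn /andP[h0 hS] tauE A delay p pnu t n x x1.
have hS1 X : 0 <= X -> X <= S -> h * X <= 1.
  move=> X0 XS; apply: (@le_trans _ _ (S^-1 * S)); last by rewrite mulVf // gt_eqF.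
  by apply: ler_pM => //; exact: ltW.
have h1 : h <= 1 by have := hS1 1 ler01; rewrite mulr1; apply; rewrite /S; lra.
have nK : 1 <= n <= (K * nu)%N%:Z.
  apply/andP; split=> //; rewrite lez_nat.
  have : (i.+1 * nu <= K * nu)%N by rewrite leq_mul2r iK orbT.
  by apply: leq_trans; rewrite mulSn addnC ltn_add2r.
have n1 : n - 1 = (i * nu + p)%N by rewrite /n -addn1 PoszD addrK.
have [de dm] := delay p pnu.
have pn_le : p%:R * h + h <= tau.
  by rewrite tauE -{2}[h]mul1r -mulrDl ler_wpM2r ?(ltW h0) // natr1 ler_nat.
have ph0 : 0 <= p%:R * h by rewrite mulr_ge0 // ltW.
have t_ab a : 0 <= a <= 1 -> piece_start i <= t + a * h <= piece_start i.+1.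
  move=> /andP[a0 a1]; rewrite piece_startS /t.
  by have := ler_piMl (ltW h0) a1; have := mulr_ge0 a0 (ltW h0); lra.
have hs1 : Cd * h ^+ (s + 1) <= 1.
  rewrite addn1 exprS mulrA; apply: (@le_trans _ _ (Cd * h)); last first.
    by rewrite mulrC; apply: hS1; rewrite // /S; lra.
  rewrite ler_piMr ?mulr_ge0 ?(ltW h0) //; apply: exprn_ile1 => //; exact: ltW.
have vM l : `|u (n - nu%:Z) (c l * h)| <= M0 + 1.
  have := wM _ (t_ab _ (c01 l)); have := de l; set W := delayed _ _; set V := u _ _.
  move=> WV Wb; have : `|V| <= `|W| + `|W - V|.
    by rewrite -{1}[V](subKr W); exact: ler_normB.
  by rewrite /M0; lra.
have y0M : `|yn (i * nu + p)%N| <= M0 + 1.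
  have := yM t; rewrite -[t]addr0 -(mul0r h) t_ab ?lexx ?ler01 // => /(_ isT).
  rewrite mul0r addr0 => yb; move: x1; rewrite /x; set Y := yn _ => x1.
  have : `|Y| <= `|y t| + `|y t - Y|.
    by rewrite -{1}[Y](subKr (y t)); exact: ler_normB.
  by rewrite /M0; lra.
have eqn := approximation_eq A nK.
have u_near a : 0 <= a <= 1 -> `|u n (a * h) - yn (i * nu + p)%N| <= 1.
  move=> a01; apply: norm_le_coord => // j; rewrite !mxE (eqn _ a01) n1.
  rewrite addrAC subrr add0r normrM (ger0_norm (ltW h0)).
  apply: (@le_trans _ _ (h * (G * (k%:R * `|B|)))); last first.
    by apply: hS1; rewrite // /S; lra.
  rewrite ler_wpM2l ?(ltW h0) //; apply: le_trans (hG _ _ a01) _.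
  rewrite ler_wpM2l //; apply: (@le_trans _ _ (\sum_(l < k) `|B|)).
    apply: ler_sum => l _; apply: le_trans (coord_le_norm _ _) _.
    apply: le_trans (ler_norm B); apply: hB.
    rewrite prod_normE ge_max /=; apply/andP; split; last by have := vM l; lra.
    have := apx_near A nK (c01 l); rewrite n1; move: y0M.
    set Y := yn _; set U := u _ _ => YM UY.
    have : `|U| <= `|U - Y| + `|Y| by rewrite -{1}[U](subrK Y); exact: ler_normD.
    by lra.
  by rewrite sumr_const card_ord -[leLHS]mulr_natl.
have ok : one_step b c s P f y (delayed i) (piece_start i) (piece_start i.+1)
    (M0 + 2) Cd h t (fun a => u n (a * h)) (fun a => u (n - nu%:Z) (a * h))
    (yn (i * nu + p)%N).
  split=> //.
  - by rewrite h0.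
  - by rewrite /t lerDl.
  - by rewrite piece_startS /t; lra.
  - by move=> a a01 j; rewrite (eqn _ a01) n1.
  - move=> l; rewrite prod_normE ge_max /=; apply/andP; split; last first.
      by have := vM l; lra.
    have := u_near _ (c01 l); move: y0M.
    set Y := yn _; set U := u _ _ => YM UY.
    have : `|U| <= `|U - Y| + `|Y| by rewrite -{1}[U](subrK Y); exact: ler_normD.
    by lra.
have [|H1 H2 H3] := step _ _ _ _ _ ok; first by apply: hS1; rewrite // /S; lra.
by split=> //; move: H3; rewrite mul1r (apx_grid A nK).
Qed.

Definition step_estimate (C : R) (h : R) (u : int -> R -> 'rV[R]_m)
    (yn : int -> 'rV[R]_m) (n : int) :=
  `|(y (t0 + n%:~R * h) - yn n) - (y (t0 + (n - 1)%:~R * h) - yn (n - 1))| <=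
      C * h ^+ (2 * s + 1) /\
  forall a, 0 <= a <= 1 ->
    `|y (t0 + (n - 1)%:~R * h + a * h) - u n (a * h)| <= C * h ^+ (s + 1).

Lemma le_step_estimate C C' h u yn n : 0 <= h -> C <= C' ->
  step_estimate C h u yn n -> step_estimate C' h u yn n.
Proof.
move=> h0 CC [H1 H2]; split=> [|a a01].
  by apply: le_trans H1 _; rewrite ler_wpM2r ?exprn_ge0.
by apply: le_trans (H2 _ a01) _; rewrite ler_wpM2r ?exprn_ge0.
Qed.

(** The induction hypothesis on the delay intervals.  The first two clauses
    start the interval of index [i], the third one is the goal for all the steps
    before it. *)
Definition piece_bound i := exists2 C, 0 <= C & forall rho, 0 < rho ->
  exists2 h0, 0 < h0 & forall nu h u yn, 0 < h <= h0 -> tau = nu%:R * h ->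
  approximation rho nu h u yn ->
  [/\ `|y (piece_start i) - yn (i * nu)%N| <= C * h ^+ (2 * s),
      delay_error C i nu h u &
      forall n : int, 1 <= n <= (i * nu)%N%:Z -> step_estimate C h u yn n].

(** On the first delay interval the delayed argument is exact. *)
Lemma piece_bound0 : piece_bound 0.
Proof.
exists 0 => // rho rho0; exists 1 => // nu h u yn /andP[h0 _] tauE A.
rewrite /piece_start !mul0r addr0 mul0n; split.
- by rewrite (apx_init A) (dde_init y_sol) subrr normr0.
- move=> p pnu e; have e0 l : e (c l) = 0.
    have /andP[cl0 cl1] := c01 l.
    have pc0 : 0 <= p%:R * h + c l * h by rewrite addr_ge0 // mulr_ge0 // ltW.
    have pc1 : p%:R * h + c l * h <= tau.
      rewrite tauE -mulrDl ler_wpM2r ?(ltW h0) //.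
      by apply: (@le_trans _ _ (p%:R + 1)); [rewrite lerD2l | rewrite natr1 ler_nat].
    rewrite /e /delayed /piece_start mul0r addr0 D_phi; last by lra.
    have np : 1 - nu%:Z <= (0 * nu + p).+1%:Z - nu%:Z <= 0.
      by rewrite mul0n add0n; lia.
    apply/eqP; rewrite subr_eq0 (apx_history A np (c01 l)); apply/eqP; congr phi.
    have -> : (0 * nu + p).+1%:Z - nu%:Z - 1 = p%:Z - nu%:Z by lia.
    by rewrite intrB -!pmulrn tauE; ring.
  split=> [l|n j ns]; first by rewrite e0 normr0 mul0r.
  rewrite /quad big1 ?mulr0 ?normr0 ?mul0r // => l _.
  by rewrite e0 mxE !mulr0.
- by move=> n /andP[n1 n0]; lia.
Qed.

(** The constant grows from one interval to the next, but only finitely many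
    times, and it is never affected by [rho]. *)
Lemma piece_boundS i : (i < K)%N -> piece_bound i -> piece_bound i.+1.
Proof.
have s2_gt0 : (1 <= 2 * s)%N by lia.
have s1_le : (s + 1 <= 2 * s)%N by lia.
move=> iK [C C0 Hi]; have [C1 C10 Hs] := piece_step iK C0.
(* By the Gronwall lemma, B bounds the grid error over h ^ (2 * s). *)
pose B := expR (C1 * tau) * (C + 1).
have B0 : 0 <= B by rewrite mulr_ge0 ?expR_ge0 ?addr_ge0.
have CB0 : 0 <= C1 * (B + 1) by rewrite mulr_ge0 ?addr_ge0.
exists (C + B + C1 * (B + 1)) => [|rho rho0]; first by rewrite !addr_ge0.
have [hi hi0 {}Hi] := Hi _ rho0; have [hs hs0 {}Hs] := Hs _ rho0.
exists (Num.min (Num.min hi hs) (1 + B)^-1).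
  by rewrite !lt_min hi0 hs0 invr_gt0 /=; lra.
move=> nu h u yn /andP[h0]; rewrite !le_min -andbA => /and3P[hhi hhs hB] tauE A.
have [end_i delay_i est_i] := Hi _ _ _ _ (introT andP (conj h0 hhi)) tauE A.
have := Hs _ _ _ _ (introT andP (conj h0 hhs)) tauE A delay_i.
move=> {Hi}{}Hs; have hge0 := ltW h0.
have hB1 : h * (1 + B) <= 1.
  apply: (@le_trans _ _ ((1 + B)^-1 * (1 + B))); first by rewrite ler_wpM2r //; lra.
  by rewrite mulVf // gt_eqF //; lra.
have hB0 : 0 <= h * B by rewrite mulr_ge0.
have h1 : h <= 1 by lra.
have exph n1 n2 : (n2 <= n1)%N -> h ^+ n1 <= h ^+ n2.
  by move=> n21; apply: ler_wiXn2l.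
have qh : h ^+ (2 * s) <= h by rewrite -[leRHS]expr1 exph.
have qs : h ^+ (2 * s) <= h ^+ (s + 1) by exact: exph.
have q0 : 0 <= h ^+ (2 * s) by rewrite exprn_ge0.
set q := h ^+ (2 * s) in qh qs q0 *.
pose t p := piece_start i + p%:R * h.
pose e p := `|y (t p) - yn (i * nu + p)%N|.
have tS p : t p.+1 = t p + h by rewrite /t mulrS mulrDl mul1r addrA addrAC.
have eB p : (p <= nu)%N -> e p + q <= B * q.
  apply: (@gronwall R e nu h C1 C q tau hge0 C10 C0 q0 tauE).
  - by move=> p'; exact: normr_ge0.
  - by rewrite /e /t mul0r addr0 addn0.
  - apply: (@le_trans _ _ (h * B)); last by lra.
    by rewrite mulrC ler_wpM2r.
  - move=> p' p'nu e1; have [_ _] := Hs _ p'nu e1; rewrite -/(e p').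
    rewrite {2}/e tS addnS; set U := y _ - _; set W := y _ - _ => UW.
    have UU : `|U| <= `|U - W| + `|W| by rewrite -{1}[U](subrK W); exact: ler_normD.
    by apply: le_trans UU _; rewrite addrC; exact: lerD (lexx _) UW.
have step p : (p < nu)%N ->
  [/\ forall a, 0 <= a <= 1 -> `|y (t p + a * h) - u (i * nu + p).+1%:Z (a * h)| <=
        C1 * (B + 1) * h ^+ (s + 1),
      forall n' j, (n' + 2 <= s)%N ->
        `|h ^+ n' * quad (fun a => (1 - a) ^+ n' *
            (y (t p + a * h) - u (i * nu + p).+1%:Z (a * h)) 0 j)| <=
        C1 * (B + 1) * q &
      `|y (t p + h) - yn (i * nu + p).+1%:Z - (y (t p) - yn (i * nu + p)%N)| <=
        C1 * (B + 1) * h ^+ (2 * s + 1)].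
  move=> pnu; have epB := eB _ (ltnW pnu).
  have e1 : e p <= 1.
    apply: (@le_trans _ _ (h * B)); last by lra.
    by apply: (@le_trans _ _ (B * q)); [lra | rewrite mulrC ler_wpM2r].
  have [Ha Hm He] := Hs _ pnu e1; rewrite -/(e p) -/(t p) in Ha Hm He.
  split=> [a a01|n' j ns|].
  - apply: le_trans (Ha _ a01) _; rewrite -mulrA ler_wpM2l // mulrDl mul1r lerD2r.
    apply: (@le_trans _ _ (B * q)); first by lra.
    by rewrite ler_wpM2l.
  - apply: le_trans (Hm _ _ ns) _; rewrite -mulrA ler_wpM2l // -/q mulrDl mul1r lerD2r.
    by lra.
  - apply: le_trans He _; rewrite -mulrA ler_wpM2l // addn1 exprS mulrCA -/q.
    by rewrite ler_wpM2l // mulrDl mul1r; lra.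
split.
- have := eB _ (leqnn nu); rewrite /e /t -tauE -piece_startS addnC -mulSn => eq.
  apply: (@le_trans _ _ (B * q)); first by lra.
  by rewrite ler_wpM2r //; lra.
- move=> p pnu e'; have [Ha Hm _] := step _ pnu.
  have e'E x : e' x = y (t p + x * h) - u (i * nu + p).+1%:Z (x * h).
    rewrite /e' /delayed piece_startS; congr (y _ - u _ _).
      by rewrite /t; ring.
    exact: delayed_index.
  split=> [l|n' j ns].
    rewrite e'E; apply: le_trans (Ha _ (c01 l)) _.
    by rewrite ler_wpM2r ?exprn_ge0 // lerDr addr_ge0.
  under eq_quad do rewrite e'E.
  by apply: le_trans (Hm _ j ns) _; rewrite ler_wpM2r // lerDr addr_ge0.
- move=> n; have [n_le|n_gt] := lerP n (i * nu)%N%:Z => /andP[n1 nS].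
    apply: le_step_estimate (est_i n _) => //; last by rewrite n1.
    by rewrite -addrA lerDl addr_ge0.
  have [p pnu nE] : exists2 p, (p < nu)%N & n = (i * nu + p).+1%:Z.
    exact: step_decomp.
  have tE : t0 + (n - 1)%:~R * h = t p.
    rewrite nE -addn1 PoszD addrK /t /piece_start tauE -pmulrn natrD natrM; ring.
  have tE' : t0 + n%:~R * h = t p + h.
    by rewrite nE /t /piece_start tauE -pmulrn -addn1 !natrD natrM; ring.
  have n1E : n - 1 = (i * nu + p)%N by rewrite nE -addn1 PoszD addrK.
  apply: (@le_step_estimate (C1 * (B + 1))) => //; first by rewrite lerDr addr_ge0.
  have [Ha _ He] := step _ pnu.
  by rewrite /step_estimate tE tE' n1E nE; split.
Qed.

Lemma piece_bounds i : (i <= K)%N -> piece_bound i.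
Proof.
elim: i => [|i IHi] iK; first exact: piece_bound0.
by apply: piece_boundS => //; apply: IHi; exact: ltnW.
Qed.

End Delay.

Unset Implicit Arguments.

Theorem theorem20 (R : realType) (s : nat) (hs : (1 <= s)%N) :
  exists r : nat,
  forall (m k q K : nat) (vnorm : 'rV[R]_m -> R) (P : nat -> {poly R})
         (b c : 'I_k -> R) (f : 'rV[R]_m * 'rV[R]_m -> 'rV[R]_m)
         (phi y : R -> 'rV[R]_m) (y0 : 'rV[R]_m) (t0 T tau : R),
  vector_norm vnorm ->
  legendre_basis P ->
  interpolatory_quadrature b c ->
  quadrature_order b c q ->
  (2 * s <= q)%N ->
  0 < tau ->
  T - t0 = K%:R * tau ->
  class_C r f ->
  class_C_itv r (t0 - tau) t0 phi ->
  dde_solution f phi y0 t0 T tau y ->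
  exists C : R, forall rho : R, 0 < rho -> \forall nu \near \oo,
  forall (h : R) (u : int -> R -> 'rV[R]_m) (yn : int -> 'rV[R]_m),
  tau = nu%:R * h ->
  pw_approximation s f P b c phi y0 t0 h rho nu (K * nu)%N u yn ->
  forall n : int, 1 <= n <= (K * nu)%N%:Z ->
    vnorm ((y (t0 + n%:~R * h) - yn n) -
        (y (t0 + (n - 1)%:~R * h) - yn (n - 1))) <= C * h ^+ (2 * s + 1) /\
    (forall a : R, 0 <= a <= 1 ->
       vnorm (y (t0 + (n - 1)%:~R * h + a * h) - u n (a * h)) <= C * h ^+ (s + 1)).
Proof.
exists (2 * s)%N => m k q K vnorm P b c f phi y y0 t0 T tau HN HP Hq Ho sq tau0 TE Cf.
move=> [D [D0 Dc Dd]] ysol.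
have exact_quad : quadrature_order b c (2 * s).
  by move=> p sp; apply: Ho; exact: leq_trans sp sq.
have [C C0 HC] := piece_bounds exact_quad HP hs (quad_abscissae Hq) tau0 TE Cf D0 Dc Dd
  ysol (leqnn K).
have [Cv Cv0 HCv] := vector_norm_le HN.
exists (Cv * C) => rho rho0; have [h0 h00 {}HC] := HC _ rho0.
near=> nu => h u yn tauE A n nK.
have nu_big : tau / h0 <= nu%:R by near: nu; exact: nbhs_infty_ger.
have nu0 : 0 < nu%:R :> R by apply: lt_le_trans nu_big; rewrite divr_gt0.
have h_gt0 : 0 < h by move: tau0; rewrite tauE pmulr_rgt0.
have h_le : h <= h0.
  by move: nu_big; rewrite ler_pdivrMr // tauE ler_pM2l.
have [_ _ /(_ n nK)[H1 H2]] := HC _ _ _ _ (introT andP (conj h_gt0 h_le)) tauE A.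
split=> [|a a01]; rewrite -mulrA; apply: le_trans (HCv _) _; apply: ler_wpM2l => //.
exact: H2.
Unshelve. all: by end_near.
Qed.
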